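(* Let $a,b\in\mathbb{R}^2$ be linearly independent over $\mathbb{R}$, let $r,s\in\mathbb{R}$ and $\nu=ra+sb$, and let $f\in L^2(\mathbb{R})$ be nonzero. Assume that $|\sigma(a,b)|>1$ and that $1,r,s$ are linearly independent over $\mathbb{Q}$. Then the four vectors $$f,\qquad \pi(a)f,\qquad \pi(b)f,\qquad \pi(\nu)f$$ are linearly independent over $\mathbb{C}$.
   Context: $L^2(\mathbb{R})$ is the complex Hilbert space of (classes of) square-integrable functions $\mathbb{R}\to\mathbb{C}$ with respect to Lebesgue measure. For $x,\omega\in\mathbb{R}$ define operators on $L^2(\mathbb{R})$ by $T_xf(t)=f(t-x)$, $M_\omega f(t)=e^{2\pi i\omega t}f(t)$, and the time-frequency shift $\pi(x,\omega)=M_\omega T_x$. For $z=(x,\omega)\in\mathbb{R}^2$ write $\pi(z)=\pi(x,\omega)$. The standard symplectic form on $\mathbb{R}^2$ is $\sigma((x,\omega),(y,\eta))=x\eta-y\omega$. *)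

(* Defs.v *)
From HB Require Import structures.
From mathcomp Require Import all_boot all_order all_algebra.
From mathcomp Require Import all_classical all_reals all_analysis.
From mathcomp Require Import measurable_realfun.
From mathcomp Require Import complex ring lra.

Set Implicit Arguments.
Unset Strict Implicit.
Unset Printing Implicit Defensive.

Import Order.TTheory GRing.Theory Num.Theory.
Import numFieldNormedType.Exports.
Import Normc.

Local Open Scope classical_set_scope.
Local Open Scope ring_scope.
Local Open Scope quotient_scope.

(* [lebesgue_measure] lives on the Borel sigma-algebra, so functions are Borel
   measurable; modulo null sets this gives the same space as Lebesgue
   measurability. *)
Definition square_integrable (R : realType) (f : R -> R[i]) : Prop :=
  [/\ measurable_fun setT (fun t : R => complex.Re (f t)),
      measurable_fun setT (fun t : R => complex.Im (f t)) &
      (\int[@lebesgue_measure R]_t ((normc (f t)) ^+ 2)%:E < +oo)%E].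

Definition sqint (R : realType) : {pred R -> R[i]} :=
  fun f => `[< square_integrable f >].
Arguments sqint {R}.

#[global] Instance ae_lebesgue_filter (R : realType) :
  Filter (almost_everywhere (@lebesgue_measure R)).
Proof. exact: ae_filter_ringOfSetsType. Qed.

Section SquareIntegrable.
Context {R : realType}.
Local Notation mu := (@lebesgue_measure R).
Implicit Types f g : R -> R[i].

Lemma normc2E (z : R[i]) : normc z ^+ 2 = complex.Re z ^+ 2 + complex.Im z ^+ 2.
Proof. by case: z => a b /=; rewrite sqr_sqrtr ?addr_ge0 ?sqr_ge0. Qed.

Lemma ReM (z w : R[i]) : complex.Re (z * w) = complex.Re z * complex.Re w - complex.Im z * complex.Im w.
Proof. by case: z w => [a b] [c d]. Qed.

Lemma ImM (z w : R[i]) : complex.Im (z * w) = complex.Re z * complex.Im w + complex.Im z * complex.Re w.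
Proof. by case: z w => [a b] [c d]. Qed.

Lemma measurable_normc2 f :
  measurable_fun setT (fun t : R => complex.Re (f t)) ->
  measurable_fun setT (fun t : R => complex.Im (f t)) ->
  measurable_fun setT (fun t : R => (normc (f t) ^+ 2)%:E).

Proof.
move=> mr mi; apply/measurable_EFinP.
under eq_fun do rewrite normc2E.
by apply: measurable_funD; apply: measurable_funX.
Qed.

Lemma sqint_submod_closed : submod_closed (@sqint R).
Proof.
split.
  apply/asboolP; split; [exact: measurable_cst|exact: measurable_cst|].
  rewrite (eq_integral (cst 0%E)) ?integral0 ?ltry// => t _.
  by rewrite /= expr0n/= addr0 sqrtr0 expr0n.
move=> a f g /asboolP[mrf mif iff] /asboolP[mrg mig ig]; apply/asboolP.
have mr : measurable_fun setT (fun t : R => complex.Re ((a *: f + g) t)).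
  rewrite (_ : (fun t => _) =
    (fun t : R => complex.Re a * complex.Re (f t) - complex.Im a * complex.Im (f t) + complex.Re (g t))).
    by apply: measurable_funD => //; apply: measurable_funB;
      apply: measurable_funM => //; exact: measurable_cst.
  apply/funext => t; rewrite -ReM (_ : (a *: f + g) t = a * f t + g t)//.
  by case: (a * f t) (g t) => [? ?] [? ?].
have mi : measurable_fun setT (fun t : R => complex.Im ((a *: f + g) t)).
  rewrite (_ : (fun t => _) =
    (fun t : R => complex.Re a * complex.Im (f t) + complex.Im a * complex.Re (f t) + complex.Im (g t))).
    by apply: measurable_funD => //; apply: measurable_funD;
      apply: measurable_funM => //; exact: measurable_cst.
  apply/funext => t; rewrite -ImM (_ : (a *: f + g) t = a * f t + g t)//.
  by case: (a * f t) (g t) => [? ?] [? ?].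
split => //.
pose k : R := 2 * normc a ^+ 2.
have k0 : 0 <= k by rewrite mulr_ge0// sqr_ge0.
apply: (@le_lt_trans _ _ (\int[mu]_t (k%:E * ((normc (f t)) ^+ 2)%:E +
    2%:E * ((normc (g t)) ^+ 2)%:E))%E).
  apply: ge0_le_integral => //.
  - by move=> t _; rewrite lee_fin sqr_ge0.
  - exact: measurable_normc2.
  - by apply: emeasurable_funD;
      apply: emeasurable_funM; (try exact: measurable_cst); exact: measurable_normc2.
  - move=> t _; rewrite -!EFinM -EFinD lee_fin /k -mulrA -exprMn -normcM.
    have -> : (a *: f + g) t = a * f t + g t by [].
    rewrite !normc2E; case: (a * f t) (g t) => [p q] [u v] /=.
    rewrite -subr_ge0 (_ : _ - _ = (p - u) ^+ 2 + (q - v) ^+ 2).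
      by rewrite addr_ge0 ?sqr_ge0.
    by rewrite !expr2; lra.
have m0 h t : (0 <= ((normc (h t : R[i])) ^+ 2)%:E :> \bar R)%E.
  by rewrite lee_fin sqr_ge0.
have mk h (c : R) :
    measurable_fun setT (fun t : R => ((normc (h t)) ^+ 2)%:E) ->
    measurable_fun setT (fun t : R => c%:E * ((normc (h t)) ^+ 2)%:E)%E.
  by move=> mh; apply: emeasurable_funM => //; exact: measurable_cst.
have mf := measurable_normc2 mrf mif; have mg := measurable_normc2 mrg mig.
have c0 h (c : R) : 0 <= c ->
    forall t : R, setT t -> (0 <= c%:E * (normc (h t : R[i]) ^+ 2)%:E)%E.
  by move=> ? t _; apply: mule_ge0.
rewrite ge0_integralD//; [|exact: c0|exact: mk|exact: c0|exact: mk].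
rewrite !ge0_integralZl//.
by rewrite lte_add_pinfty// lte_mul_pinfty// lee_fin.
Qed.

HB.instance Definition _ :=
  GRing.isSubmodClosed.Build R[i] (R -> R[i]) (@sqint R) sqint_submod_closed.

Lemma measurable_translation (x : R) :
  measurable_fun setT (fun t : R => t - x).
Proof. by apply: measurable_funB => //; exact: measurable_cst. Qed.

Lemma lebesgue_measure_translation (x : R) (A : set R) : measurable A ->
  pushforward mu ((fun t : R => t - x) : _ -> measurableTypeR R) A = mu A.
Proof.
move=> mA; apply/esym/lebesgue_measure_unique => //=.
  exact: measurable_translation.
move=> _ _ [[a b]] _ <-.
rewrite /pushforward (_ : _ @^-1` _ = `]a + x, b + x]%classic); last first.
  by apply/seteqP; split => t /=; rewrite !in_itv/= ltrBrDr lerBlDr.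
rewrite !lebesgue_measure_itv/= !lte_fin ltrD2r -!EFinB.
by rewrite opprD addrACA subrr addr0.
Qed.

Lemma ge0_integral_translation (x : R) (h : R -> \bar R) :
  measurable_fun setT h -> (forall t, 0 <= h t)%E ->
  (\int[mu]_t h (t - x)%R = \int[mu]_t h t)%E.
Proof.
move=> mh h0.
pose phi : _ -> measurableTypeR R := fun t : R => t - x.
have mphi : measurable_fun setT phi := measurable_translation x.
transitivity (\int[pushforward mu phi]_t h t)%E.
  by rewrite ge0_integral_pushforward//.
by apply: eq_measure_integral => A mA _; exact: lebesgue_measure_translation.
Qed.

Lemma ae_translation (x : R) (P : R -> Prop) :
  (\forall t \ae mu, P t) -> \forall t \ae mu, P (t - x).
Proof.
move=> [A [mA A0 PA]]; exists ((fun t : R => t - x) @^-1` A); split.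
- by rewrite -[X in measurable X]setTI; exact: measurable_translation.
- by rewrite -[LHS]/(pushforward mu _ A) lebesgue_measure_translation.
- by move=> t /=; exact: PA.
Qed.

End SquareIntegrable.

Definition L2fun (R : realType) := {f : R -> R[i] | f \in @sqint R}.

HB.instance Definition _ (R : realType) := [isSub of L2fun R for @sval _ _].
HB.instance Definition _ (R : realType) := [Choice of L2fun R by <:].
HB.instance Definition _ (R : realType) :=
  [SubChoice_isSubLmodule of L2fun R by <:].

Definition ae_zero (R : realType) : {pred L2fun R} :=
  fun f => `[< \forall t \ae @lebesgue_measure R, val f t = 0 >].
Arguments ae_zero {R}.

Lemma ae_zero_submod_closed (R : realType) : submod_closed (@ae_zero R).
Proof.
split; first by apply/asboolP/aeW.
move=> a f g /asboolP f0 /asboolP g0; apply/asboolP.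
apply: filterS2 f0 g0 => t f0 g0.
by rewrite linearP/= -[LHS]/(a * val f t + val g t) f0 g0 mulr0 addr0.
Qed.

HB.instance Definition _ (R : realType) :=
  GRing.isSubmodClosed.Build R[i] (L2fun R) (@ae_zero R)
    (@ae_zero_submod_closed R).

Definition L2 (R : realType) : Type := Quotient.quot (@ae_zero R).

HB.instance Definition _ (R : realType) := GRing.Zmodule.on (L2 R).
HB.instance Definition _ (R : realType) :=
  ZmodQuotient.on (L2 R).

Section L2Theory.
Context {R : realType}.
Implicit Types (f g : L2fun R).

Lemma L2_eqP f g : \pi_(L2 R) f = \pi_(L2 R) g <->
  \forall t \ae @lebesgue_measure R, val f t = val g t.
Proof.
split.
  move=> /eqP; rewrite -Quotient.idealrBE => /asboolP; apply: filterS => t.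
  by rewrite linearB/= => /eqP; rewrite subr_eq0 => /eqP.
move=> fg; apply/eqP; rewrite -Quotient.idealrBE; apply/asboolP.
by move: fg; apply: filterS => t fg; rewrite linearB/= -[LHS]/(val f t - val g t) fg subrr.
Qed.

Definition L2_scale (c : R[i]) := lift_op1 (L2 R) ( *:%R c).

Lemma pi_scale c : {morph \pi_(L2 R) : f / c *: f >-> L2_scale c f}.
Proof.
move=> f; unlock L2_scale; apply/L2_eqP.
have /esym/L2_eqP : \pi_(L2 R) (repr (\pi_(L2 R) f)) = \pi_(L2 R) f by rewrite reprK.
by apply: filterS => t E; rewrite !linearZ/= -[LHS]/(c * _) E.
Qed.
Canonical pi_scale_morph c := PiMorph1 (pi_scale c).

End L2Theory.

Section L2Lmodule.
Context {R : realType}.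
Implicit Types (c d : R[i]) (u v : L2 R).

Let scaleA c d v : L2_scale c (L2_scale d v) = L2_scale (c * d) v.
Proof. by rewrite -[v]reprK !piE scalerA. Qed.

Let scale1 : left_id 1 (@L2_scale R).
Proof. by move=> v; rewrite -[v]reprK !piE scale1r. Qed.

Let scaleDr : right_distributive (@L2_scale R) +%R.
Proof.
by move=> c u v; rewrite -[u]reprK -[v]reprK !piE scalerDr.
Qed.

Let scaleDl v : {morph (@L2_scale R)^~ v : c d / c + d}.
Proof. by move=> c d; rewrite -[v]reprK !piE scalerDl. Qed.

HB.instance Definition _ := GRing.Zmodule_isLmodule.Build R[i] (L2 R)
  scaleA scale1 scaleDr scaleDl.

Lemma pi_L2Z c (f : L2fun R) :
  \pi_(L2 R) (c *: f) = c *: \pi_(L2 R) f.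
Proof. exact: pi_scale. Qed.

End L2Lmodule.

(* e^(i theta); the analysis library has no complex exponential. *)
Definition expi (R : realType) (theta : R) : R[i] := (cos theta +i* sin theta)%C.

Section TimeFrequencyShifts.
Context {R : realType}.
Local Notation mu := (@lebesgue_measure R).
Implicit Types (x w : R) (f : L2fun R).

Lemma normc_expi (theta : R) : normc (expi theta) = 1.
Proof. by rewrite /= cos2Dsin2 sqrtr1. Qed.

Lemma sqint_translation x f : (fun t : R => val f (t - x)) \in @sqint R.
Proof.
case: f => f /= /asboolP[mr mi fi]; apply/asboolP.
have mx := measurable_translation x.
split; [exact: (measurableT_comp mr)|exact: (measurableT_comp mi)|].
rewrite (ge0_integral_translation x (h := fun t => (normc (f t) ^+ 2)%:E))//.
  exact: measurable_normc2.
by move=> t; rewrite lee_fin sqr_ge0.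
Qed.

Lemma sqint_modulation w f :
  (fun t : R => expi (2 * pi * w * t) * val f t) \in @sqint R.
Proof.
case: f => f /= /asboolP[mr mi fi]; apply/asboolP.
have ml : measurable_fun setT (fun t : R => 2 * pi * w * t).
  by apply: measurable_funM => //; exact: measurable_cst.
have mcos : measurable_fun setT (fun t : R => cos (2 * pi * w * t)).
  apply: (measurableT_comp _ ml).
  by apply: continuous_measurable_fun; exact: continuous_cos.
have msin : measurable_fun setT (fun t : R => sin (2 * pi * w * t)).
  apply: (measurableT_comp _ ml).
  by apply: continuous_measurable_fun; exact: continuous_sin.
split.
- under eq_fun do rewrite ReM.
  by apply: measurable_funB; apply: measurable_funM.
- under eq_fun do rewrite ImM.
  by apply: measurable_funD; apply: measurable_funM.
- by under eq_integral do rewrite normcM normc_expi mul1r.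
Qed.

Definition translation_fun x f : L2fun R := exist (fun g => g \in sqint) _ (sqint_translation x f).
Definition modulation_fun w f : L2fun R := exist (fun g => g \in sqint) _ (sqint_modulation w f).

Definition translation x := lift_op1 (L2 R) (translation_fun x).
Definition modulation w := lift_op1 (L2 R) (modulation_fun w).

Lemma repr_pi_ae f :
  \forall t \ae mu, val f t = val (repr (\pi_(L2 R) f)) t.
Proof. by apply/L2_eqP; rewrite reprK. Qed.

Lemma pi_translation x :
  {morph \pi_(L2 R) : f / translation_fun x f >-> translation x f}.
Proof.
move=> f; unlock translation; apply/L2_eqP.
exact: (ae_translation x (repr_pi_ae f)).
Qed.

Lemma pi_modulation w :
  {morph \pi_(L2 R) : f / modulation_fun w f >-> modulation w f}.
Proof.
move=> f; unlock modulation; apply/L2_eqP.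
by apply: filterS (repr_pi_ae f) => t /= ->.
Qed.

(* The point (x, w) of the plane is the row vector with entries [z 0 0] = x and
   [z 0 1] = w. *)
Definition tfshift (z : 'rV[R]_2) (u : L2 R) : L2 R :=
  modulation (z 0 1) (translation (z 0 0) u).

Lemma tfshift_pi z f : tfshift z (\pi_(L2 R) f) =
  \pi_(L2 R) (modulation_fun (z 0 1) (translation_fun (z 0 0) f)).
Proof. by rewrite /tfshift -pi_translation -pi_modulation. Qed.

Definition symplectic (z w : 'rV[R]_2) : R := z 0 0 * w 0 1 - w 0 0 * z 0 1.

End TimeFrequencyShifts.

Definition linearly_independent (K : nzRingType) (V : lmodType K) (n : nat)
    (v : n.-tuple V) : Prop :=
  forall c : 'I_n -> K, \sum_(i < n) c i *: tnth v i = 0 -> forall i, c i = 0.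

(* [R] carries no canonical structure of vector space over [rat], hence the
   explicit embedding [ratr]. *)
Definition rat_independent (R : realType) (n : nat) (x : n.-tuple R) : Prop :=
  forall q : 'I_n -> rat,
    \sum_(i < n) ratr (q i) * tnth x i = 0 -> forall i, q i = 0.

(* Main.v *)
(* Suppose the four vectors are dependent and let F represent f. If the relation
   involves pi(nu)f, then pi(lambda + k nu)f lies in the span of the vectors
   pi(lambda')f with lambda' a lattice point at bounded distance (for k <= K).
   By Kronecker's theorem the points lambda + k nu are uniformly dense, so by
   strong continuity every pi(z)f is within epsilon of the span of the pi(lambda)f
   with lambda near z. Take a parallelogram of area A containing about
   A/|sigma(a,b)| lattice points, and let P be the projection on the span of the
   corresponding vectors. The integral of <P pi(z)f, pi(z)f> over the parallelogram
   is almost A |f|^2, whereas Moyal's inequality (the integral over the whole plane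
   of |<e, pi(z)f>|^2 is at most |e|^2 |f|^2) bounds it by rank(P) |f|^2, about
   A/|sigma(a,b)| |f|^2. Hence |sigma(a,b)| <= 1. If the relation involves only f,
   pi(a)f and pi(b)f, then n^2 lattice shifts of f lie in a space of dimension 2n
   and the same comparison fails for large n. Only a discretised Moyal inequality
   is needed: Bessel's inequality in the frequency variable, then Tonelli. *)
Require Import Defs.
From mathcomp Require Import all_boot all_order all_algebra.
From mathcomp Require Import all_classical all_reals all_analysis.
From mathcomp Require Import measurable_realfun.
From mathcomp Require Import complex.
From mathcomp Require Import ring lra zify.

Set Implicit Arguments.
Unset Strict Implicit.
Unset Printing Implicit Defensive.

Import Order.TTheory GRing.Theory Num.Theory.
Import numFieldNormedType.Exports.
Import Normc.
Local Open Scope classical_set_scope.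
Local Open Scope ring_scope.
Local Open Scope quotient_scope.

(** * Positive semidefinite forms and spans *)

(** The comparison with 1 leaves no room for a lost constant in the leading term, and this shapes
    the proof. Dimensions are counted with the real part of the scalar product, a form on
    representatives that is only semidefinite; the factor 2 between real and complex dimension is
    cancelled by testing [u] and ['i *: u] together. Bessel's inequality in frequency is sharp on a
    window of length [1 / |theta|], but it requires the shifted function to be supported in such a
    window. Hence the tested shifts are those of a truncation [G] of [F], with [theta] small enough
    for its support, while the linear relation, which truncation would destroy, is used for [F]
    alone. The frequency is sampled and the translation integrated, so the parallelogram is cut by
    lines parallel to [a], written as graphs over the translation axis. This needs a nonzero first
    coordinate of [a]; otherwise [a] and [b] are exchanged. Kronecker's theorem is needed with a
    time bound uniform in the target: it fixes the width of the boundary layer, whose [O(p)] lattice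
    points are negligible against [p^2]. *)

Record psd_form (R : realType) (V : lmodType R[i]) (B : V -> V -> R) : Prop :=
  PsdForm {
    formC : forall u v, B u v = B v u ;
    formD : forall u v w, B (u + v) w = B u w + B v w ;
    formZ : forall (a : R) u v, B (a%:C%C *: u) v = a * B u v ;
    form_ge0 : forall u, 0 <= B u u }.

Section PsdForms.
Context {R : realType} {V : lmodType R[i]}.
Implicit Types (B : V -> V -> R) (u v w : V).

Section Basics.
Variables (B : V -> V -> R) (hB : psd_form B).

Lemma formDr u v w : B u (v + w) = B u v + B u w.
Proof. by rewrite formC// formD// !(formC hB u). Qed.

Lemma formZr (a : R) u v : B u (a%:C%C *: v) = a * B u v.
Proof. by rewrite formC// formZ// (formC hB u). Qed.

Lemma form0 u : B 0 u = 0.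
Proof. by rewrite -(scale0r 0) (formZ hB 0) mul0r. Qed.

Lemma formN u v : B (- u) v = - B u v.
Proof. by apply/eqP; rewrite -addr_eq0 addrC -formD// subrr form0. Qed.

Lemma formB u v w : B (u - v) w = B u w - B v w.
Proof. by rewrite formD// formN. Qed.

Lemma formBr u v w : B u (v - w) = B u v - B u w.
Proof. by rewrite formC// formB !(formC hB u). Qed.

Lemma form_suml (I : Type) (s : seq I) (F : I -> V) u :
  B (\sum_(i <- s) F i) u = \sum_(i <- s) B (F i) u.
Proof.
by elim: s => [|i s IH]; rewrite ?(big_nil, big_cons) ?form0// formD// IH.
Qed.

Lemma form_cauchy u v : B u v ^+ 2 <= B u u * B v v.
Proof.
have H a : 0 <= B u u - 2 * a * B u v + a ^+ 2 * B v v.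
  have := form_ge0 hB (u - a%:C%C *: v).
  rewrite formB !formBr formZ// !formZr formZ// (formC hB v u).
  by move=> h; apply: (le_trans h); lra.
have [v0|] := eqVneq (B v v) 0.
  have h := H ((B u u + 1) * B u v).
  rewrite v0 !mulr0 !addr0 in h *.
  have [-> |n0] := eqVneq (B u v) 0; first by rewrite expr0n.
  have := form_ge0 hB u; have := sqr_ge0 (B u v); rewrite !expr2 in h *.
  move=> h1 h2; exfalso.
  have h3 : 0 < B u v * B u v by rewrite -expr2 exprn_even_gt0.
  (* With [B v v = 0] the bound in [H] is affine in the parameter, and this value turns it into
     [- B u u - 2], which is negative. *)
  have := H ((B u u + 1) / (B u v)); rewrite v0 mulr0 addr0 -mulrA divfK//.
  by lra.
move=> v0; have vp : 0 < B v v by rewrite lt_neqAle eq_sym v0 form_ge0.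
have := H (B u v / B v v).
rewrite -(pmulr_lge0 _ vp).
have -> : (B u u - 2 * (B u v / B v v) * B u v + (B u v / B v v) ^+ 2 * B v v)
   * B v v = B u u * B v v - B u v ^+ 2 by field.
by rewrite subr_ge0.
Qed.

Lemma form_null u v : B u u = 0 -> B u v = 0.
Proof.
move=> u0; have := form_cauchy u v; rewrite u0 mul0r => h.
by apply/eqP; rewrite -sqrf_eq0 eq_le h sqr_ge0.
Qed.

Lemma form_null_add u v : B v v = 0 -> B (u + v) (u + v) = B u u.
Proof.
move=> v0; rewrite formD// !formDr v0 (formC hB u v) (form_null u v0).
by rewrite !addr0.
Qed.

(** Stands in for the triangle inequality, since only squared norms occur; constants such as
    [e / 24] and [L2norm2 F / 40] below pay for the factors 2. *)
Lemma form_parallelogram u v :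
  B (u + v) (u + v) <= 2 * B u u + 2 * B v v.
Proof.
have := form_ge0 hB (u - v); rewrite formB !formBr formD// !formDr.
by rewrite (formC hB v u); lra.
Qed.

Lemma form_orthogonal_bessel (I : eqType) (s : seq I) (g : I -> V) (l : R) u :
  uniq s -> 0 < l ->
  {in s &, forall i j, B (g i) (g j) = if i == j then l else 0} ->
  \sum_(i <- s) B u (g i) ^+ 2 <= l * B u u.
Proof.
move=> us l0 hg.
pose S := \sum_(i <- s) B u (g i) ^+ 2.
pose p := \sum_(i <- s) (B u (g i))%:C%C *: g i.
have up : B p u = S.
  rewrite /p form_suml; apply: eq_bigr => i _.
  by rewrite formZ// (formC hB (g i)) expr2.
have pp : B p p = l * S.
  rewrite {1}/p form_suml /S mulr_sumr !big_seq; apply: eq_bigr => i si.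
  rewrite formZ// (formC hB _ p) /p form_suml (bigD1_seq i)//= big1_seq ?addr0.
    by rewrite formZ// hg// eqxx expr2; ring.
  move=> j /andP[ji sj]; rewrite formZ// hg// (negbTE ji) mulr0//.
have := form_ge0 hB (u - (l^-1)%:C%C *: p).
rewrite formB !formBr formZ// !formZr formZ// (formC hB u p) up pp -/S.
rewrite -(pmulr_rge0 _ l0) => h.
have : l * (B u u - l^-1 * S - (l^-1 * S - l^-1 * (l^-1 * (l * S)))) =
  l * B u u - S by field; rewrite gt_eqF.
by move=> e; rewrite e subr_ge0 in h.
Qed.

End Basics.

(** For orthonormal [e] this is the form of the components orthogonal to [e]. Being a form of the
    same kind, it has its own Cauchy-Schwarz inequality, which drives the induction in
    [gram_schmidt]. *)
Lemma psd_form_residual B (e : seq V) : psd_form B ->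
  (forall u, \sum_(v <- e) B u v ^+ 2 <= B u u) ->
  psd_form (fun u v => B u v - \sum_(w <- e) B u w * B v w).
Proof.
move=> hB He; split.
- move=> u v; rewrite (formC hB); congr (_ - _).
  by apply: eq_bigr => w _; rewrite mulrC.
- move=> u v w; rewrite formD//.
  under eq_bigr do rewrite formD// mulrDl.
  by rewrite big_split/=; ring.
- move=> a u v; rewrite formZ//.
  under eq_bigr do rewrite formZ// -mulrA.
  by rewrite -mulr_sumr mulrBr.
- by move=> u; rewrite subr_ge0; apply: le_trans (He u); rewrite le_eqVlt;
    apply/orP; left; apply/eqP; apply: eq_bigr => w _; rewrite expr2.
Qed.

(* [e] is only a Bessel system: vectors of [L] that depend on the previous ones
   up to null vectors contribute [0] to it. *)
Lemma gram_schmidt B (L : seq V) : psd_form B -> exists e : seq V,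
  [/\ size e = size L, {in e, forall v, B v v <= 1},
      (forall u, \sum_(v <- e) B u v ^+ 2 <= B u u) &
      {in L, forall v, B v v <= \sum_(w <- e) B v w ^+ 2}].
Proof.
move=> hB; elim: L => [|x L [e [se e1 eB eL]]].
  by exists [::]; split=> // u; rewrite big_nil form_ge0.
have hQ := psd_form_residual hB eB.
set Q := fun u v => _ in hQ.
have QE u : Q u u = B u u - \sum_(w <- e) B u w ^+ 2.
  by rewrite /Q; under eq_bigr do rewrite -expr2.
have LQ v : v \in L -> Q v v = 0.
  by move=> /eL h; apply/eqP; rewrite eq_le (form_ge0 hQ) QE subr_le0 h.
pose y := x - \sum_(w <- e) (B x w)%:C%C *: w.
have Qy u : B u y = Q u x.
  rewrite formBr//; congr (_ - _); rewrite formC// form_suml//.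
  by apply: eq_bigr => w _; rewrite formZ// (formC hB w) mulrC.
have [x0|x0] := eqVneq (Q x x) 0.
  exists (0 :: e); split => /=; first by rewrite se.
  - move=> v; rewrite inE => /predU1P[->|/e1//].
    by rewrite form0// ler01.
  - by move=> u; rewrite big_cons (formC hB) form0// expr0n add0r.
  - move=> v; rewrite inE big_cons (formC hB) form0// expr0n add0r.
    by move=> /predU1P[->|/eL//]; move: x0; rewrite QE => /eqP; rewrite subr_eq0 => /eqP ->.
have xp : 0 < Q x x by rewrite lt_neqAle eq_sym x0 (form_ge0 hQ).
pose s := Num.sqrt (Q x x).
have s2 : s ^+ 2 = Q x x by rewrite sqr_sqrtr// ltW.
have s0 : s != 0 by rewrite -sqrf_eq0 s2.
pose e0 := (s^-1)%:C%C *: y.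
have Be0 u : B u e0 ^+ 2 = Q u x ^+ 2 / Q x x.
  by rewrite formZr// Qy exprMn exprVn s2 mulrC.
(* Bessel's inequality for the enlarged system is Cauchy-Schwarz for the residual form,
   [Q u x ^+ 2 / Q x x <= Q u u]. *)
have bes u : \sum_(v <- e0 :: e) B u v ^+ 2 <= B u u.
  rewrite big_cons Be0 -lerBrDr -QE ler_pdivrMr//.
  exact: form_cauchy.
exists (e0 :: e); split => //=; first by rewrite se.
- move=> v; rewrite inE => /predU1P[->|/e1//].
  have : B e0 e0 ^+ 2 <= B e0 e0.
    apply: le_trans (bes e0); rewrite big_cons lerDl sumr_ge0// => w _.
    exact: sqr_ge0.
  have := form_ge0 hB e0; rewrite le_eqVlt => /predU1P[<-//|p].
  by rewrite expr2 ger_pMr.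
- move=> v; rewrite inE big_cons Be0 => /predU1P[->|vL].
    by rewrite expr2 mulfK// QE subrK.
  by rewrite (form_null hQ _ (LQ _ vL)) expr0n mul0r add0r eL.
Qed.

(* Membership in the complex subspace generated by [L] and the null vectors of
   [B]. *)
Definition in_span B (L : seq V) (w : V) : Prop :=
  forall W : V -> Prop,
    (forall c u v, W u -> W v -> W (c *: u + v)) ->
    (forall u, B u u = 0 -> W u) -> {in L, forall v, W v} -> W w.

Section Span.
Variables (B : V -> V -> R) (hB : psd_form B).
Implicit Types L : seq V.

Lemma in_span_mem L v : v \in L -> in_span B L v.
Proof. by move=> vL W _ _; apply. Qed.

Lemma in_span_null L u : B u u = 0 -> in_span B L u.
Proof. by move=> u0 W _ W0 _; exact: W0. Qed.

Lemma in_span_lin L c u v :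
  in_span B L u -> in_span B L v -> in_span B L (c *: u + v).
Proof. by move=> Lu Lv W Wl W0 WL; apply: (Wl); [exact: (Lu W Wl W0 WL)|exact: (Lv W Wl W0 WL)]. Qed.

Lemma in_span0 L : in_span B L 0.
Proof. by apply: in_span_null; rewrite form0. Qed.

Lemma in_spanD L u v : in_span B L u -> in_span B L v -> in_span B L (u + v).
Proof. by move=> Lu Lv; rewrite -(scale1r u); exact: in_span_lin. Qed.

Lemma in_spanZ L c u : in_span B L u -> in_span B L (c *: u).
Proof. by move=> Lu; rewrite -(addr0 (_ *: _)); apply: in_span_lin => //; exact: in_span0. Qed.

Lemma in_span_trans L L' w :
  {in L, forall v, in_span B L' v} -> in_span B L w -> in_span B L' w.
Proof.
move=> h Lw; apply: (Lw (in_span B L')) => //; first by move=> *; exact: in_span_lin.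
exact: in_span_null.
Qed.

Hypothesis Bi : forall u v, B ('i *: u) ('i *: v) = B u v.

(* The bound [2 * size L] counts real dimensions: [u] and ['i *: u] are projected
   together. *)
Lemma span_bessel L : exists e : seq V,
  [/\ size e = (size L).*2, {in e, forall v, B v v <= 1} &
      forall u w eps, in_span B L w -> B (u - w) (u - w) <= eps ->
        2 * (B u u - eps) <=
        \sum_(v <- e) (B u v ^+ 2 + B ('i *: u) v ^+ 2)].
Proof.
have [e [se e1 eB eL]] := gram_schmidt (L ++ [seq 'i *: v | v <- L]) hB.
exists e; split => //; first by rewrite se size_cat size_map addnn.
have hQ := psd_form_residual hB eB.
set Q := fun u v => _ in hQ.
have QE u : Q u u = B u u - \sum_(w <- e) B u w ^+ 2.
  by rewrite /Q; under eq_bigr do rewrite -expr2.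
have Qle u : Q u u <= B u u.
  by rewrite QE gerBl sumr_ge0// => w _; exact: sqr_ge0.
(* A [Q]-null [w] can be subtracted without changing the residual, so [Q u u = Q (u - w) (u - w) <=
   B (u - w) (u - w) <= eps]. *)
have key u w eps : Q w w = 0 -> B (u - w) (u - w) <= eps ->
    B u u - eps <= \sum_(v <- e) B u v ^+ 2.
  move=> w0 h; rewrite lerBlDl -lerBlDr -QE.
  rewrite -(subrK w u) (form_null_add hQ)//; exact: le_trans (Qle _) h.
have ci (c : R[i]) (u : V) :
    c *: u = (complex.Re c)%:C%C *: u + (complex.Im c)%:C%C *: ('i *: u).
  by rewrite scalerA -scalerDl; congr (_ *: _); case: c => a b; apply/eqP;
    rewrite eq_complex/=; apply/andP; split; apply/eqP; ring.
(* [Q] is only real bilinear and not known to be invariant under ['i], so [w] and ['i *: w] are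
   carried together through the closure under complex scalars. *)
have spanQ w : in_span B L w -> Q w w = 0 /\ Q ('i *: w) ('i *: w) = 0.
  move=> Lw; apply: (Lw (fun w => Q w w = 0 /\ Q ('i *: w) ('i *: w) = 0)).
  - have lin a b u v w' : Q u u = 0 -> Q v v = 0 -> Q w' w' = 0 ->
       Q (a%:C%C *: u + b%:C%C *: v + w') (a%:C%C *: u + b%:C%C *: v + w') = 0.
      move=> u0 v0 ?; rewrite form_null_add// form_null_add//.
        by rewrite (formZ hQ) formZr// u0 !mulr0.
      by rewrite (formZ hQ) formZr// v0 !mulr0.
    have ii (u : V) : 'i *: ('i *: u) = (-1)%:C%C *: u.
      by rewrite scalerA -expr2 sqr_i; congr (_ *: _); rewrite rmorphN rmorph1.
    move=> c u v [u1 u2] [v1 v2]; split.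
      by rewrite ci; exact: lin.
    have -> : 'i *: (c *: u + v) =
        (complex.Re c)%:C%C *: ('i *: u) + (complex.Im c)%:C%C *: ('i *: ('i *: u))
        + 'i *: v.
      rewrite scalerDr; congr (_ + _); rewrite (ci c u) scalerDr.
      by congr (_ + _); rewrite !scalerA; congr (_ *: _); ring.
    by apply: lin => //; rewrite ii (formZ hQ) formZr// u1 !mulr0.
  - have Q0 u : B u u = 0 -> Q u u = 0.
      by move=> u0; apply/eqP; rewrite eq_le (form_ge0 hQ) andbT -u0 Qle.
    by move=> u u0; split; apply: Q0 => //; rewrite Bi.
  - have Q0 u : u \in L ++ [seq 'i *: v | v <- L] -> Q u u = 0.
      move=> /eL h; apply/eqP; rewrite eq_le (form_ge0 hQ) andbT QE.
      by rewrite subr_le0.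
    move=> v vL; split; apply: Q0; rewrite mem_cat ?vL//.
    by rewrite map_f ?orbT.
move=> u w eps /spanQ[w0 iw0] h.
have h1 := key _ _ _ w0 h.
have h2 : B ('i *: u) ('i *: u) - eps <= \sum_(v <- e) B ('i *: u) v ^+ 2.
  by apply: key iw0 _; rewrite -scalerBr Bi.
by rewrite Bi in h2; rewrite big_split/=; lra.
Qed.

End Span.
End PsdForms.

(** * Kronecker's theorem in dimension two *)

Section TrigonometricSums.
Context {R : realType}.
Implicit Types (x y t d : R).

Lemma sinDpin x (n : nat) : sin (x + n%:R * pi) = (-1) ^+ n * sin x.
Proof.
elim: n => [|n IH]; first by rewrite mul0r addr0 mul1r.
by rewrite mulrSr mulrDl mul1r addrA sinDpi IH exprS mulN1r mulNr.
Qed.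

Lemma cosDpin x (n : nat) : cos (x + n%:R * pi) = (-1) ^+ n * cos x.
Proof.
elim: n => [|n IH]; first by rewrite mul0r addr0 mul1r.
by rewrite mulrSr mulrDl mul1r addrA cosDpi IH exprS mulN1r mulNr.
Qed.

Lemma sqr_sinDpiz x (n : int) : sin (x + n%:~R * pi) ^+ 2 = sin x ^+ 2.
Proof.
case: n => n; first by rewrite sinDpin exprMn sqrr_sign mul1r.
rewrite NegzE mulrNz -[in RHS](subrK (n.+1%:R * pi) x) sinDpin exprMn.
by rewrite sqrr_sign mul1r mulNr.
Qed.

Lemma sqr_cosDpiz x (n : int) : cos (x + n%:~R * pi) ^+ 2 = cos x ^+ 2.
Proof.
case: n => n; first by rewrite cosDpin exprMn sqrr_sign mul1r.
rewrite NegzE mulrNz -[in RHS](subrK (n.+1%:R * pi) x) cosDpin exprMn.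
by rewrite sqrr_sign mul1r mulNr.
Qed.

Lemma sin_pi_neq0 x : (forall n : int, x != n%:~R) -> sin (pi * x) != 0.
Proof.
move=> xn; rewrite -sqrf_eq0.
pose n := Num.floor x.
have /andP[n1 n2] := Num.Theory.floor_itv x.
have -> : pi * x = pi * (x - n%:~R) + n%:~R * pi by ring.
rewrite sqr_sinDpiz sqrf_eq0 gt_eqF// sin_gt0_pi//.
rewrite pmulr_rgt0 ?pi_gt0// subr_gt0 lt_neqAle eq_sym xn n1/=.
rewrite gtr_pMr ?pi_gt0// ltrBlDl.
by move: n2; rewrite intrD addrC.
Qed.

Lemma sqr_cos_pi_le x d : 0 < d < 1 / 2 -> (forall n : int, d <= `|x - n%:~R|) ->
  cos (pi * x) ^+ 2 <= cos (pi * d) ^+ 2.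
Proof.
move=> /andP[d0 d1] far.
pose n := Num.floor (x + 1 / 2).
have /andP[n1 n2] := Num.Theory.floor_itv (x + 1 / 2).
have -> : pi * x = pi * (x - n%:~R) + n%:~R * pi by ring.
rewrite sqr_cosDpiz -[in X in X <= _]cos_norm normrM (ger0_norm (pi_ge0 R)).
have h : `|x - n%:~R| <= 1 / 2.
  rewrite intrD in n2.
  by rewrite ler_norml; apply/andP; split; lra.
have p0 := pi_gt0 R.
have hd := far n.
rewrite lerXn2r ?nnegrE ?cos_ge0_pihalf//.
- have : 0 <= pi * `|x - n%:~R| by rewrite mulr_ge0 ?pi_ge0.
  have : pi * `|x - n%:~R| <= pi * (1 / 2) by rewrite ler_pM2l.
  by move=> ? ?; apply/andP; split; lra.
- have : 0 <= pi * d by rewrite mulr_ge0 ?pi_ge0 ?ltW.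
  have : pi * d <= pi * (1 / 2) by rewrite ler_pM2l// ltW.
  by move=> ? ?; apply/andP; split; lra.
rewrite le_eqVlt; move: hd; rewrite le_eqVlt => /predU1P[->|hd].
  by rewrite eqxx.
have mem t : 0 <= t <= 1 / 2 -> pi * t \in `[0, pi].
  move=> /andP[t0 t1]; rewrite in_itv/= mulr_ge0 ?(ltW p0)//=.
  by rewrite ger_pMr//; lra.
apply/orP; right; rewrite ltr_cos ?mem ?h ?normr_ge0 ?(ltW d0) ?(ltW d1)//.
by rewrite ltr_pM2l.
Qed.

(** Multiplication by [2 * sin (pi * x)] makes the sum telescope. The bound depends neither on the
    length nor on the phase [y]; this is what makes the time bound in [kronecker2] uniform in the
    target point. *)
Lemma sum_cos_bounded x : (forall n : int, x != n%:~R) ->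
  exists A : R, forall (N : nat) y,
    `|\sum_(m < N) cos (2 * pi * (m%:R * x) + y)| <= A.
Proof.
move=> xn; have s0 := sin_pi_neq0 xn; pose s := sin (pi * x).
have sp : 0 < `|s| by rewrite normr_gt0.
exists (`|s|^-1) => N y.
pose g (m : nat) := sin (2 * pi * (m%:R * x) + y - pi * x).
have -> : \sum_(m < N) cos (2 * pi * (m%:R * x) + y) = (g N - g 0%N) / (2 * s).
  have s20 : 2 * s != 0 by rewrite mulf_neq0 ?pnatr_eq0.
  apply: (mulIf s20); rewrite divfK// mulr_suml.
  rewrite -(telescope_sumr _ (leq0n N)) big_mkord; apply: eq_bigr => m _.
  rewrite /g (_ : m.+1%:R = m%:R + 1 :> R); last by rewrite natr1.
  
  have -> : 2 * pi * ((m%:R + 1) * x) + y - pi * x =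
    2 * pi * (m%:R * x) + y + pi * x by ring.
  by rewrite sinB sinD /s; ring.
rewrite normrM normfV (normrM 2) (ger0_norm (ler0n _ 2)) invfM mulrA ler_pdivrMr//.
rewrite mulVf ?normr_eq0// ler_pdivrMr// mul1r.
apply: le_trans (ler_normB _ _) _.
by rewrite -[2]/(1 + 1) lerD ?sin_max.
Qed.

(** The even power has integer frequencies [p - i] only, and its constant term, hence its mean, is
    the central coefficient. *)
Lemma powr_2cos (p : nat) x : (2 * cos (pi * x)) ^+ p.*2 =
  \sum_(i < p.*2.+1) 'C(p.*2, i)%:R * cos (2 * pi * ((p%:Z - i%:Z)%:~R * x)).
Proof.
pose e y : R[i] := expi y.
have eD y y' : e (y + y') = e y * e y'.
  by rewrite /e /expi cosD sinD; apply/eqP; rewrite eq_complex/=;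
    apply/andP; split; apply/eqP; ring.
have eX y n : e y ^+ n = e (n%:R * y).
  elim: n => [|n IH]; first by rewrite mul0r /e /expi cos0 sin0.
  by rewrite exprS IH -eD mulrSr; congr e; ring.
have E : e (pi * x) + e (- (pi * x)) = (2 * cos (pi * x))%:C%C.
  by rewrite /e /expi sinN cosN; apply/eqP; rewrite eq_complex/=;
    apply/andP; split; apply/eqP; ring.
have ReS (n : nat) (F : 'I_n -> R[i]) :
    complex.Re (\sum_(i < n) F i) = \sum_(i < n) complex.Re (F i).
  by apply: (big_morph (@complex.Re R)) => // -[? ?] [? ?].
have := congr1 (@complex.Re R) (exprDn (e (pi * x)) (e (- (pi * x))) p.*2).
rewrite E -rmorphXn/= ReS => ->; apply: eq_bigr => i _.
have -> : forall (z : R[i]) k, complex.Re (z *+ k) = k%:R * complex.Re z.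
  move=> z; elim => [|k IH]; first by rewrite mulr0n mul0r.
  by rewrite mulrS -natr1 mulrDl mul1r -IH; case: z (z *+ k) {IH} => a b [c d]/=;
     rewrite addrC.
rewrite !eX -eD /e /expi/=; congr (_ * cos _).
rewrite natrB -1?ltnS//.
have -> : p.*2%:R = 2 * p%:R :> R by rewrite -mul2n natrM.
by rewrite intrB; ring.
Qed.

(** The central coefficient is the largest of [2p + 1] coefficients with sum [4 ^ p]. So the peak of
    the kernel exceeds its mean by a factor of at most [2p + 1], which geometric decay away from the
    integers beats. *)
Lemma bin_mid_ge (p : nat) : (4 ^ p <= (p.*2.+1) * 'C(p.*2, p))%N.
Proof.
elim: p => // p IH.
have h : (p.+1 * 'C(p.+1.*2, p.+1) = 2 * (p.*2.+1 * 'C(p.*2, p)))%N.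
  have e1 : (p.*2.+2 * 'C(p.*2.+1, p) = p.+1 * 'C(p.*2.+2, p.+1))%N.
    exact: mul_bin_diag.
  have e2 : 'C(p.*2.+1, p.+1) = 'C(p.*2.+1, p).
    have <- : (p.*2.+1 - p = p.+1)%N by rewrite -addnn -addSn addnK.
    by rewrite bin_sub// -addnn -addSn leq_addl.
  have e3 : (p.*2.+1 * 'C(p.*2, p) = p.+1 * 'C(p.*2.+1, p.+1))%N.
    exact: mul_bin_diag.
  by rewrite doubleS -e1 e3 e2 -doubleS -mul2n mulnA.
rewrite -(leq_pmul2l (ltn0Sn p)).
rewrite [X in (_ <= X)%N]mulnCA h expnS; move: IH; move: (4 ^ p)%N (p.*2.+1 * _)%N => Y Z YZ.
apply: (@leq_trans (p.+1 * (4 * Z))%N); first by rewrite !leq_pmul2l.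
rewrite !mulnA leq_mul2r; apply/orP; right.
by rewrite -addnn; lia.
Qed.

Lemma ex_small_geometric y : 0 <= y < 1 ->
  exists p : nat, p.*2.+1%:R * y ^+ p.*2 <= 1 / 4.
Proof.
move=> /andP[y0 y1].
move: y0; rewrite le_eqVlt => /predU1P[<-|y0].
  by exists 1%N; rewrite expr0n/= mulr0; lra.
pose h := y^-1 - 1; have h0 : 0 < h by rewrite subr_gt0 invf_gt1.
have B n : n%:R * h <= (y^-1) ^+ n.
  elim: n => [|n IH]; first by rewrite mul0r expr0.
  have i1 : 1 <= y^-1 ^+ n by rewrite exprn_ege1// -[1]invr1 lef_pV2 ?posrE// ltW.
  have -> : y^-1 = 1 + h by rewrite /h; ring.
  have -> : 1 + h = y^-1 by rewrite /h; ring.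
  rewrite exprS -natr1.
  have -> : y^-1 * y^-1 ^+ n = y^-1 ^+ n + h * y^-1 ^+ n by rewrite /h; ring.
  rewrite mulrDl mul1r lerD// ler_peMr// ltW//.
(* By [B] the power [y ^+ p.*2] is at most [1 / (p h)^2], and [2p + 1 <= 3p]; the product is at most
   [3 / (p h^2)], which 12 brings below 1/4. *)
have [p pB] : exists p : nat, 12 / h ^+ 2 < p%:R.
  exists (Num.truncn (12 / h ^+ 2)).+1; exact: Num.Theory.truncnS_gt.
have p0 : 0 < p%:R :> R by apply: le_lt_trans pB; rewrite divr_ge0 ?sqr_ge0.
exists p.
have hp : 0 < p%:R * h by rewrite mulr_gt0.
have {}B : (p%:R * h) ^+ 2 <= y^-1 ^+ p.*2.
  rewrite -addnn exprD -expr2 lerXn2r ?nnegrE ?(ltW hp)//.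
  by rewrite exprn_ge0// invr_ge0 ltW.
have yp : 0 < y ^+ p.*2 by rewrite exprn_gt0.
rewrite exprVn in B.
have {}B : y ^+ p.*2 * (p%:R * h) ^+ 2 <= 1 by rewrite -ler_pdivlMl// mulr1.
rewrite ltr_pdivrMr ?exprn_gt0// in pB.
have p1 : 1 <= p%:R :> R.
  by move: p0; rewrite ltr0n -(ler_nat R).
have -> : p.*2.+1%:R = 2 * p%:R + 1 :> R by rewrite -natr1 -mul2n natrM.
set Y := y ^+ _ in B yp *; set P := p%:R in p1 B pB p0 *.
have : 3 * P * Y * (P * h ^+ 2) <= 3 * 1.
  have -> : 3 * P * Y * (P * h ^+ 2) = 3 * (Y * (P * h) ^+ 2) by ring.
  by rewrite ler_pM2l.
have h1 : 3 * P * Y * 12 <= 3 * P * Y * (P * h ^+ 2).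
  by rewrite ler_pM2l ?ltW// !mulr_gt0.
have h2 : (2 * P + 1) * Y <= 3 * P * Y by rewrite ler_pM2r//; lra.
by lra.
Qed.

End TrigonometricSums.

Section Kronecker.
Context {R : realType}.
Variables r s : R.
Implicit Types (g : nat -> R -> R -> R) (c : R).

(* [g m u v] stands for the value at time [m] of an observable of the orbit
   [m (r, s)] seen from the base point [(u, v)]. *)
Definition has_mean g c := exists A : R, forall (N : nat) (u v : R),
  `|\sum_(m < N) g m u v - N%:R * c| <= A.

Lemma eq_has_mean g g' c c' : (forall m u v, g m u v = g' m u v) -> c = c' ->
  has_mean g c -> has_mean g' c'.
Proof.
move=> gg' <- [A hA]; exists A => N u v.
by under eq_bigr do rewrite -gg'; exact: hA.
Qed.

Lemma has_meanD g g' c c' : has_mean g c -> has_mean g' c' ->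
  has_mean (fun m u v => g m u v + g' m u v) (c + c').
Proof.
move=> [A hA] [A' hA']; exists (A + A') => N u v.
rewrite big_split/= mulrDr opprD addrACA.
by apply: (le_trans (ler_normD _ _)); exact: (lerD (hA N u v) (hA' N u v)).
Qed.

Lemma has_meanZ k g c : has_mean g c ->
  has_mean (fun m u v => k * g m u v) (k * c).
Proof.
move=> [A hA]; exists (`|k| * A) => N u v.
by rewrite -mulr_sumr mulrCA -mulrBr normrM ler_wpM2l ?hA.
Qed.

Lemma has_mean_sum (n : nat) (G : 'I_n -> nat -> R -> R -> R) (C : 'I_n -> R) :
  (forall i, has_mean (G i) (C i)) ->
  has_mean (fun m u v => \sum_(i < n) G i m u v) (\sum_(i < n) C i).
Proof.
elim: n G C => [|n IH] G C h.
  by exists 0 => N u v; under eq_bigr do rewrite big_ord0;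
    rewrite big_ord0 big1// mulr0 subrr normr0.
have [A hA] := has_meanD (IH _ _ (fun i => h (widen_ord (leqnSn n) i)))
  (h ord_max).
exists A => N u v; rewrite big_ord_recr/=.
under eq_bigr do rewrite big_ord_recr/=.
exact: hA.
Qed.

Hypothesis rs : rat_independent [tuple 1; r; s].

Lemma int_independent (j l k : int) :
  j%:~R * r + l%:~R * s = k%:~R -> j = 0 /\ l = 0.
Proof.
move=> e.
pose q (i : 'I_3) : rat := nth 0 [:: (- k)%:~R; j%:~R; l%:~R] i.
have := rs (q := q); rewrite !big_ord_recl big_ord0 !(tnth_nth 0)/= /q/=.
rewrite !ratr_int mulr1 addr0 e mulrNz addNr => /(_ erefl) h.
have := h (lift ord0 ord0); have := h (lift ord0 (lift ord0 ord0)).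
by rewrite /= => /eqP + /eqP; rewrite !intr_eq0 => /eqP -> /eqP ->.
Qed.

(** The orthogonality behind Weyl's criterion: for a nontrivial character [j r + l s] is not an
    integer, and the base point only changes the phase. *)
Lemma has_mean_cos (j l : int) :
  has_mean (fun m u v => cos (2 * pi * (j%:~R * (m%:R * r - u)) +
                            2 * pi * (l%:~R * (m%:R * s - v))))
    ((j == 0) && (l == 0))%:R.
Proof.
have [/andP[/eqP-> /eqP->]|n0] := boolP ((j == 0) && (l == 0)).
  exists 0 => N u v; rewrite mulr1.
  under eq_bigr do rewrite !mul0r !mulr0 addr0 cos0.
  by rewrite sumr_const card_ord subrr normr0.
have [k|A hA] := @sum_cos_bounded R (j%:~R * r + l%:~R * s).
  apply/eqP => /int_independent[j0 l0].
  by rewrite j0 l0 !eqxx in n0.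
exists A => N u v; rewrite mulr0 subr0.
apply: le_trans (hA N (- (2 * pi * (j%:~R * u + l%:~R * v)))).
rewrite le_eqVlt; apply/orP; left; apply/eqP; congr (`|_|).
by apply: eq_bigr => m _; congr cos; ring.
Qed.

Variable p : nat.
Let K x := (2 * cos (pi * x)) ^+ p.*2 : R.
Let C : R := 'C(p.*2, p)%:R.

Lemma sum_bin_central :
  \sum_(i < p.*2.+1) 'C(p.*2, i)%:R * ((p%:Z - i%:Z == 0)%:R) = C.
Proof.
have pp : (p < p.*2.+1)%N by rewrite ltnS -addnn leq_addl.
rewrite (bigD1 (Ordinal pp))//= subrr eqxx mulr1 big1 ?addr0// => i ip.
rewrite subr_eq0 (_ : (p%:Z == i%:Z) = false) ?mulr0//.
by apply/negbTE; apply: contra ip => /eqP[e]; apply/eqP/val_inj.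
Qed.

Lemma has_mean_powr_l : has_mean (fun m u v => K (m%:R * r - u)) C.
Proof.
apply: eq_has_mean (has_mean_sum (fun i : 'I_p.*2.+1 =>
  has_meanZ 'C(p.*2, i)%:R (has_mean_cos (p%:Z - i%:Z) 0))) => [m u v|].
  rewrite /K powr_2cos; apply: eq_bigr => i _.
  by rewrite [in X in _ + X]mul0r mulr0 addr0.
by rewrite -sum_bin_central; apply: eq_bigr => i _; rewrite eqxx andbT.
Qed.

Lemma has_mean_powr_r : has_mean (fun m u v => K (m%:R * s - v)) C.
Proof.
apply: eq_has_mean (has_mean_sum (fun i : 'I_p.*2.+1 =>
  has_meanZ 'C(p.*2, i)%:R (has_mean_cos 0 (p%:Z - i%:Z)))) => [m u v|].
  rewrite /K powr_2cos; apply: eq_bigr => i _.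
  by rewrite [in X in X + _]mul0r mulr0 add0r.
by rewrite -sum_bin_central.
Qed.

Lemma has_mean_powr_lr :
  has_mean (fun m u v => K (m%:R * r - u) * K (m%:R * s - v)) (C ^+ 2).
Proof.
(* A product of two cosines is half the sum of the characters of frequencies [(j, l)] and
   [(j, - l)]; the constant is split in the same way. *)
have -> : C ^+ 2 = \sum_(i < p.*2.+1) \sum_(j < p.*2.+1)
    ('C(p.*2, i)%:R * 'C(p.*2, j)%:R / 2) *
      (((p%:Z - i%:Z == 0) && (p%:Z - j%:Z == 0))%:R +
       ((p%:Z - i%:Z == 0) && (- (p%:Z - j%:Z) == 0))%:R).
  rewrite -sum_bin_central expr2 mulr_suml; apply: eq_bigr => i _.
  rewrite mulr_sumr; apply: eq_bigr => j _; rewrite oppr_eq0 -mulnb natrM.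
  by field.
apply: eq_has_mean (has_mean_sum (fun i : 'I_p.*2.+1 =>
  has_mean_sum (fun j : 'I_p.*2.+1 =>
  has_meanZ ('C(p.*2, i)%:R * 'C(p.*2, j)%:R / 2)
   (has_meanD (has_mean_cos (p%:Z - i%:Z) (p%:Z - j%:Z))
     (has_mean_cos (p%:Z - i%:Z) (- (p%:Z - j%:Z))))))) => [m u v|//].
rewrite /K !powr_2cos mulr_suml; apply: eq_bigr => i _.
rewrite mulr_sumr; apply: eq_bigr => j _.
by rewrite mulrNz mulNr mulrN cosB cosD; field.
Qed.

End Kronecker.

(* The product of the kernels [(2 cos pi x)^(2p)] in both coordinates has mean
   [C(2p, p)^2] along the orbit, each factor has mean [C(2p, p)], and each is much
   smaller than that away from the integers; so the orbit cannot avoid a square. *)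
Lemma kronecker2 (R : realType) (r s d : R) :
  rat_independent [tuple 1; r; s] -> 0 < d ->
  exists K : nat, forall u v : R, exists m : nat, exists j l : int,
    [/\ (m <= K)%N, `|u - j%:~R - m%:R * r| < d & `|v - l%:~R - m%:R * s| < d].
Proof.
(* Below 1/2, [cos (pi * d)] is nonnegative and bounds [|cos (pi * x)|] at every [x] at distance at
   least [d] from the integers. *)
move=> rs d0; wlog d1 : d d0 / d < 1 / 2.
  move=> h; have := h (Num.min d (1 / 4)).
  rewrite lt_min d0 gt_min => /(_ ltac:(lra)).
  move=> /(_ ltac:(apply/orP; right; lra)) [K hK].
  exists K => u v; have [m [j [l [h1 h2 h3]]]] := hK u v.
  by exists m, j, l; split => //; [move: h2|move: h3]; rewrite lt_min => /andP[].
pose y : R := cos (pi * d).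
have y01 : 0 <= y < 1.
  have p0 := pi_gt0 R.
  have pd : pi * d < pi / 2 by rewrite -[pi / 2]mulr1 -mulrA ltr_pM2l//; lra.
  have pd0 : 0 < pi * d by rewrite mulr_gt0.
  apply/andP; split; first by apply: cos_ge0_pihalf; apply/andP; split; lra.
  by rewrite -cos0 ltr_cos// in_itv/=; apply/andP; split; lra.
have [p hp] := ex_small_geometric y01.
pose C : R := 'C(p.*2, p)%:R.
have [A hA] := has_mean_powr_lr rs p.
have [A1 hA1] := has_mean_powr_l rs p.
have [A2 hA2] := has_mean_powr_r rs p.
have C1 : 1 <= C.
  by rewrite /C -[1]/(1%:R) ler_nat bin_gt0 -addnn leq_addl.
have mid : 4 ^+ p <= p.*2.+1%:R * C by rewrite -natrM -natrX ler_nat bin_mid_ge.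
(* If the orbit avoids the square, the three sums give [N C^2 <= 2 |A| + C (|A1| + |A2|) / 2], which
   this [N] contradicts because [C >= 1]. *)
pose N := (Num.truncn (2 * `|A| + C * (`|A1| + `|A2|))).+1.
have hN : 2 * `|A| + C * (`|A1| + `|A2|) < N%:R by exact: Num.Theory.truncnS_gt.
exists N => u v.
apply: contrapT => no.
pose K x := (2 * cos (pi * x)) ^+ p.*2 : R.
have K0 x : 0 <= K x by rewrite /K -mul2n exprM exprn_ge0// sqr_ge0.
(* Away from the integers [K x <= 4^p y^(2p) <= (2p + 1) C y^(2p) <= C / 4]. A quarter is enough:
   two factors of mean [C] then yield at most half of the mean [C ^+ 2], up to bounded errors. *)
pose e : R := C / 4.
have far x : (forall n : int, d <= `|x - n%:~R|) -> K x <= e.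
  move=> fx; have h := @sqr_cos_pi_le R x d _ fx.
  have {}h : cos (pi * x) ^+ 2 <= y ^+ 2 by apply: h; rewrite d0.
  rewrite /K exprMn -mul2n !exprM (_ : 2 ^+ 2 = 4 :> R); last by ring.
  apply: (@le_trans _ _ (4 ^+ p * (y ^+ 2) ^+ p)).
    by rewrite ler_pM2l ?exprn_gt0// lerXn2r ?nnegrE ?sqr_ge0.
  apply: (@le_trans _ _ (p.*2.+1%:R * C * (y ^+ 2) ^+ p)).
    by rewrite ler_wpM2r// exprn_ge0// sqr_ge0.
  rewrite -exprM mul2n mulrAC /e mulrC ler_pM2l ?(lt_le_trans ltr01)//.
  by rewrite mul1r in hp.
have bad (m : 'I_N) : K (m%:R * r - u) * K (m%:R * s - v) <=
    e * (K (m%:R * r - u) + K (m%:R * s - v)).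
  have e0 : 0 <= e by rewrite divr_ge0// (le_trans ler01).
  have [nr|/existsNP[j /negP]] :=
      pselect (forall n : int, d <= `|m%:R * r - u - n%:~R|).
    rewrite mulrDr ler_wpDl ?mulr_ge0 ?ler_wpM2r ?far//.
  rewrite -ltNge => hj.
  have [ns|/existsNP[l /negP]] :=
      pselect (forall n : int, d <= `|m%:R * s - v - n%:~R|).
    rewrite mulrDr ler_wpDr ?mulr_ge0// mulrC ler_wpM2r ?far//.
  rewrite -ltNge => hl; exfalso; apply: no; exists m, (- j), (- l).
  split; first by rewrite ltnW.
    by rewrite distrC in hj; rewrite mulrNz; apply: le_lt_trans hj;
      rewrite le_eqVlt; apply/orP; left; apply/eqP; congr (`|_|); ring.
  by rewrite distrC in hl; rewrite mulrNz; apply: le_lt_trans hl;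
      rewrite le_eqVlt; apply/orP; left; apply/eqP; congr (`|_|); ring.
have : \sum_(m < N) K (m%:R * r - u) * K (m%:R * s - v) <=
    \sum_(m < N) e * (K (m%:R * r - u) + K (m%:R * s - v)).
  by apply: ler_sum => m _; exact: bad.
rewrite -mulr_sumr big_split/=.
move: (hA N u v) (hA1 N u v) (hA2 N u v); rewrite -/C.
move=> /ler_normlP[a1 a2] /ler_normlP[b1 b2] /ler_normlP[c1 c2].
set S := \sum_(m < N) _ * _; set S1 := \sum_(m < N) K (_ * r - _).
set S2 := \sum_(m < N) K _.
move=> hS.
have hS' : S <= e * (2 * (N%:R * C) + `|A1| + `|A2|).
  apply: le_trans hS _; rewrite ler_wpM2l//.
    by rewrite divr_ge0 // (le_trans ler01).
  have := ler_norm A1; have := ler_norm A2.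
  rewrite -/K -/S1 in b2; rewrite -/K -/S2 in c2; lra.
have aA := ler_norm A.
have hS2 : N%:R * C ^+ 2 - `|A| <= S by rewrite -/S in a1; lra.
have : N%:R * C * C <= 2 * `|A| + C * (`|A1| + `|A2|) / 2.
  have ee : e * (2 * (N%:R * C) + `|A1| + `|A2|) =
    N%:R * C * C / 2 + C * (`|A1| + `|A2|) / 4 by rewrite /e; field.
  by rewrite ee in hS'; rewrite expr2 mulrA in hS2; lra.
have : N%:R <= N%:R * C * C.
  have h1 : N%:R <= N%:R * C by rewrite ler_peMr.
  by apply: (le_trans h1); rewrite ler_peMr// mulr_ge0// (le_trans ler01).
have : 0 <= C * (`|A1| + `|A2|) by rewrite mulr_ge0 ?addr_ge0// (le_trans ler01).
lra.
Qed.

(** * The real inner product of L2 and time-frequency shifts *)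

Section InnerProduct.
Context {R : realType}.
Local Notation mu := (@lebesgue_measure R).
Implicit Types (f g : L2fun R) (z w : R[i]).

(** The real part of [z] times the conjugate of [w]. Once integrated to a form [B], the sum
    [B u v ^+ 2 + B ('i *: u) v ^+ 2] is the squared modulus of the complex scalar product. *)
Definition cdot z w : R :=
  complex.Re z * complex.Re w + complex.Im z * complex.Im w.

Lemma cdotzz z : cdot z z = normc z ^+ 2.
Proof. by rewrite normc2E /cdot -!expr2. Qed.

Lemma cdotDl z z' w : cdot (z + z') w = cdot z w + cdot z' w.
Proof. by case: z z' => [? ?] [? ?]; rewrite /cdot/=; ring. Qed.

Lemma cdotMM z z' w : cdot (z' * z) (z' * w) = normc z' ^+ 2 * cdot z w.
Proof.
by rewrite normc2E; case: z z' w => [? ?] [? ?] [? ?]; rewrite /cdot/=; ring.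
Qed.

Lemma cdot_le z w : `|cdot z w| <= normc z ^+ 2 + normc w ^+ 2.
Proof.
rewrite !normc2E; case: z w => [a b] [c d]; rewrite /cdot/= ler_norml.
have := sqr_ge0 (a - c); have := sqr_ge0 (b - d).
have := sqr_ge0 (a + c); have := sqr_ge0 (b + d).
have := sqr_ge0 a; have := sqr_ge0 b; have := sqr_ge0 c; have := sqr_ge0 d.
by rewrite !expr2 => *; apply/andP; split; lra.
Qed.

Lemma L2_measurable_Re f : measurable_fun setT (fun t : R => complex.Re (val f t)).
Proof. by case: f => f /= /asboolP[]. Qed.

Lemma L2_measurable_Im f : measurable_fun setT (fun t : R => complex.Im (val f t)).
Proof. by case: f => f /= /asboolP[]. Qed.

Lemma L2_fin f : (\int[mu]_t (normc (val f t) ^+ 2)%:E < +oo)%E.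
Proof. by case: f => f /= /asboolP[]. Qed.

Lemma L2_measurable_normc2 f :
  measurable_fun setT (fun t : R => normc (val f t) ^+ 2).
Proof.
apply/measurable_EFinP; apply: measurable_normc2.
  exact: L2_measurable_Re.
exact: L2_measurable_Im.
Qed.

Lemma L2_integrable f :
  mu.-integrable setT (EFin \o (fun t : R => normc (val f t) ^+ 2)).
Proof.
apply/integrableP; split.
  by apply/measurable_EFinP; exact: L2_measurable_normc2.
under eq_integral do rewrite /= ger0_norm ?sqr_ge0//.
exact: L2_fin.
Qed.

Lemma measurable_cdot f g :
  measurable_fun setT (fun t : R => cdot (val f t) (val g t)).
Proof.
by apply: measurable_funD; apply: measurable_funM;
  try exact: L2_measurable_Re; exact: L2_measurable_Im.
Qed.

Lemma integrable_cdot f g :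
  mu.-integrable setT (EFin \o (fun t : R => cdot (val f t) (val g t))).
Proof.
apply: (@le_integrable _ _ _ mu setT measurableT _
   (EFin \o (fun t : R => normc (val f t) ^+ 2 + normc (val g t) ^+ 2))).
- by apply/measurable_EFinP; exact: measurable_cdot.
- move=> t _ /=; rewrite lee_fin (le_trans (cdot_le _ _))//.
  exact: ler_norm.
- have := integrableD measurableT (L2_integrable f) (L2_integrable g).
  by apply: eq_integrable.
Qed.

Definition L2form f g : R := \int[mu]_t cdot (val f t) (val g t).

Lemma L2form_psd : psd_form (@L2form).
Proof.
split.
- by move=> f g; apply: eq_Rintegral => t _; rewrite /cdot; ring.
- move=> f f' g; rewrite -RintegralD//; try exact: integrable_cdot.
  by apply: eq_Rintegral => t _; rewrite -cdotDl.
- move=> a f g; rewrite -RintegralZl//; try exact: integrable_cdot.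
  apply: eq_Rintegral => t _.
  rewrite (_ : val (a%:C%C *: f) t = a%:C%C * val f t)//.
  by case: (val f t) => [? ?]; rewrite /cdot/=; ring.
- by move=> f; apply: Rintegral_ge0 => t _; rewrite cdotzz sqr_ge0.
Qed.

Lemma L2form_i f g : L2form ('i *: f) ('i *: g) = L2form f g.
Proof.
apply: eq_Rintegral => t _.
rewrite (_ : val ('i *: f) t = 'i * val f t)// (_ : val ('i *: g) t = 'i * val g t)//.
by rewrite cdotMM normc2E/= expr0n add0r expr1n mul1r.
Qed.

Definition L2norm2 f : R := L2form f f.

Lemma L2norm2E f : (L2norm2 f)%:E = (\int[mu]_t (normc (val f t) ^+ 2)%:E)%E.
Proof.
rewrite /L2norm2 /L2form /Rintegral fineK.
  by apply: eq_integral => t _; rewrite cdotzz.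
under eq_integral do rewrite cdotzz.
by rewrite ge0_fin_numE ?L2_fin//; apply: integral_ge0 => t _; rewrite lee_fin sqr_ge0.
Qed.

Lemma L2norm2_ge0 f : 0 <= L2norm2 f.
Proof. exact: (form_ge0 L2form_psd). Qed.

Lemma L2norm2_Z (c : R[i]) f : L2norm2 (c *: f) = normc c ^+ 2 * L2norm2 f.
Proof.
rewrite /L2norm2 /L2form -RintegralZl//; last exact: integrable_cdot.
by apply: eq_Rintegral => t _; rewrite -cdotMM.
Qed.

Lemma L2norm2_eq0 f :
  L2norm2 f = 0 <-> \forall t \ae mu, val f t = 0.
Proof.
have e : (\int[mu]_t `|(normc (val f t) ^+ 2)%:E|)%E = (L2norm2 f)%:E.
  by rewrite L2norm2E; apply: eq_integral => t _; rewrite /= ger0_norm ?sqr_ge0.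
have mf : measurable_fun setT (fun t : R => (normc (val f t) ^+ 2)%:E).
  by apply/measurable_EFinP; exact: L2_measurable_normc2.
have [h1 h2] := ae_eq_integral_abs mu measurableT mf.
rewrite e in h1 h2; split.
  move=> f0; have := h1 (congr1 EFin f0); apply: filterS => t /(_ I)[].
  by move=> /eqP; rewrite sqrf_eq0 => /eqP/eq0_normc.
move=> h; suff : (L2norm2 f)%:E = 0%:E by case.
by apply: h2; move: h; apply: filterS => t -> _; rewrite normc0 expr0n.
Qed.

Lemma L2norm2B f g :
  L2norm2 (f - g) <= 2 * L2norm2 f + 2 * L2norm2 g.
Proof.
have := form_parallelogram L2form_psd f (- g).
rewrite (_ : L2form (- g) (- g) = L2norm2 g)//.
by rewrite (formN L2form_psd) (formC L2form_psd) (formN L2form_psd) opprK.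
Qed.

Lemma L2norm2D f g :
  L2norm2 (f + g) <= 2 * L2norm2 f + 2 * L2norm2 g.
Proof. exact: (form_parallelogram L2form_psd). Qed.

End InnerProduct.

Section Shifts.
Context {R : realType}.
Local Notation mu := (@lebesgue_measure R).
Implicit Types (f g : L2fun R) (x y v w : R).

Lemma expiD (a b : R) : expi (a + b) = expi a * expi b.
Proof.
by rewrite /expi cosD sinD; apply/eqP; rewrite eq_complex/=;
  apply/andP; split; apply/eqP; ring.
Qed.

Lemma expi0 : expi (0 : R) = 1.
Proof. by rewrite /expi cos0 sin0. Qed.

Lemma expiNr (a : R) : expi a * expi (- a) = 1.
Proof. by rewrite -expiD subrr expi0. Qed.

Definition shift x w f : L2fun R := modulation_fun w (translation_fun x f).

Lemma shift_lin x w (c : R[i]) f g :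
  shift x w (c *: f + g) = c *: shift x w f + shift x w g.
Proof.
apply: val_inj; apply/funext => t.
rewrite -[LHS]/(expi (2 * pi * w * t) * (c * val f (t - x) + val g (t - x))).
rewrite -[RHS]/(c * (expi (2 * pi * w * t) * val f (t - x)) +
  expi (2 * pi * w * t) * val g (t - x)).
by rewrite mulrDr mulrCA.
Qed.

Lemma shift_null x w : shift x w 0 = 0.
Proof. by apply: val_inj; apply/funext => t; exact: mulr0. Qed.

Lemma shiftD x w f g : shift x w (f + g) = shift x w f + shift x w g.
Proof. by rewrite -[f]scale1r shift_lin !scale1r. Qed.

Lemma shiftZ x w c f : shift x w (c *: f) = c *: shift x w f.
Proof. by rewrite -[_ *: f]addr0 shift_lin shift_null addr0. Qed.

Lemma shiftB x w f g : shift x w (f - g) = shift x w f - shift x w g.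
Proof. by rewrite -[- g]scaleN1r shiftD shiftZ scaleN1r. Qed.

Lemma shift_comp x w y v f :
  shift x w (shift y v f) = expi (- (2 * pi * v * x)) *: shift (x + y) (w + v) f.
Proof.
apply: val_inj; apply/funext => t.
rewrite -[LHS]/(expi (2 * pi * w * t) *
  (expi (2 * pi * v * (t - x)) * val f (t - x - y))).
rewrite -[RHS]/(expi (- (2 * pi * v * x)) *
  (expi (2 * pi * (w + v) * t) * val f (t - (x + y)))).
by rewrite !mulrA -!expiD opprD addrA; congr (expi _ * _); ring.
Qed.

Lemma L2norm2_shift x w f : L2norm2 (shift x w f) = L2norm2 f.
Proof.
suff : (L2norm2 (shift x w f))%:E = (L2norm2 f)%:E by case.
rewrite !L2norm2E.
rewrite -(ge0_integral_translation x (h := fun t => (normc (val f t) ^+ 2)%:E)).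
- by apply: eq_integral => t _; rewrite normcM normc_expi mul1r.
- by apply/measurable_EFinP; exact: L2_measurable_normc2.
- by move=> t; rewrite lee_fin sqr_ge0.
Qed.

End Shifts.

(** * A discrete Moyal inequality *)

Section WindowedExponentials.
Context {R : realType}.
Local Notation mu := (@lebesgue_measure R).
Implicit Types (f g F E : L2fun R).

Lemma L2_mul (phi : R -> R[i]) (C : R) f :
  measurable_fun setT (fun t : R => complex.Re (phi t)) ->
  measurable_fun setT (fun t : R => complex.Im (phi t)) ->
  (forall t, normc (phi t) <= C) ->
  exists g : L2fun R, forall t, val g t = phi t * val f t.
Proof.
move=> mr mi pC.
suff h : (fun t => phi t * val f t) \in @sqint R.
  by exists (exist (fun k : R -> R[i] => k \in @sqint R) _ h).
have mR : measurable_fun setT (fun t : R => complex.Re (phi t * val f t)).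
  under eq_fun do rewrite Defs.ReM.
  by apply: measurable_funB; apply: measurable_funM => //;
    [exact: L2_measurable_Re|exact: L2_measurable_Im].
have mI : measurable_fun setT (fun t : R => complex.Im (phi t * val f t)).
  under eq_fun do rewrite Defs.ImM.
  by apply: measurable_funD; apply: measurable_funM => //;
    [exact: L2_measurable_Im|exact: L2_measurable_Re].
apply/asboolP; split => //.
apply: (@le_lt_trans _ _ (\int[mu]_t ((C ^+ 2)%:E * (normc (val f t) ^+ 2)%:E))%E).
  apply: ge0_le_integral => //.
  - by move=> t _; rewrite lee_fin sqr_ge0.
  - exact: measurable_normc2.
  - apply: emeasurable_funM; first exact: measurable_cst.
    by apply/measurable_EFinP; exact: L2_measurable_normc2.
  - move=> t _; rewrite -EFinM lee_fin normcM exprMn ler_wpM2r ?sqr_ge0//.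
    by rewrite lerXn2r ?nnegrE ?sqrtr_ge0//= ?(le_trans _ (pC 0))//;
      case: (phi _) => *; exact: sqrtr_ge0.
have m2 : measurable_fun setT (fun t : R => (normc (val f t) ^+ 2)%:E).
  by apply/measurable_EFinP; exact: L2_measurable_normc2.
have n2 t : setT t -> (0 <= (normc (val f t) ^+ 2)%:E)%E.
  by move=> _; rewrite lee_fin sqr_ge0.
rewrite ge0_integralZl// ?lee_fin ?sqr_ge0//.
by rewrite lte_mul_pinfty ?lee_fin ?sqr_ge0//; exact: L2_fin.
Qed.

Lemma L2_indic (p q : R) :
  exists g : L2fun R, forall t, val g t = (\1_(`[p, q]%classic) t)%:C%C.
Proof.
have mA : measurable `[p, q]%classic by exact: measurable_itv.
suff h : (fun t => (\1_(`[p, q]%classic) t)%:C%C) \in @sqint R.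
  by exists (exist (fun k : R -> R[i] => k \in @sqint R) _ h).
apply/asboolP; split; [exact: measurable_indic|exact: measurable_cst|].
have -> : (\int[mu]_t (normc ((\1_(`[p, q]%classic) t)%:C%C : R[i]) ^+ 2)%:E =
    \int[mu]_t (\1_(`[p, q]%classic) t)%:E)%E.
  apply: eq_integral => t _; rewrite /= expr0n addr0 sqr_sqrtr ?sqr_ge0// indicE.
  by case: (_ \in _); rewrite ?expr1n ?expr0n.
rewrite integral_indic// setIT; have : (mu `[p, q]%classic < +oo)%E.
  by rewrite lebesgue_measure_itv; case: ifP; rewrite ?ltry// -EFinB ltry.
by [].
Qed.

Lemma measurable_expi_Re (k : R) :
  measurable_fun setT (fun t : R => complex.Re (expi (k * t))).
Proof.
have ml : measurable_fun setT (fun t : R => k * t) by exact: mulrl_measurable.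
apply: (measurableT_comp _ ml).
by apply: continuous_measurable_fun; exact: continuous_cos.
Qed.

Lemma measurable_expi_Im (k : R) :
  measurable_fun setT (fun t : R => complex.Im (expi (k * t))).
Proof.
have ml : measurable_fun setT (fun t : R => k * t) by exact: mulrl_measurable.
apply: (measurableT_comp _ ml).
by apply: continuous_measurable_fun; exact: continuous_sin.
Qed.

Lemma L2_window (k p q : R) : exists g : L2fun R,
  forall t, val g t = expi (k * t) * (\1_(`[p, q]%classic) t)%:C%C.
Proof.
have [i hi] := L2_indic p q.
have e1 (t : R) : normc (expi (k * t)) <= 1 by rewrite normc_expi.
have [g hg] := L2_mul i (measurable_expi_Re k) (measurable_expi_Im k) e1.
by exists g => t; rewrite hg hi.
Qed.

Section OnePeriod.
Variables (theta x : R).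
Hypothesis theta0 : theta != 0.
Let h := (2 * `|theta|)^-1.
Let I := `[x - h, x + h]%classic.

Let tp : 0 < `|theta|. Proof. by rewrite normr_gt0. Qed.
Let h0 : 0 < h. Proof. by rewrite invr_gt0 mulr_gt0. Qed.

(** [I] is one full period centred at [x]. The integrals over it of [cos (a t)] and [sin (a t)] both
    carry the factor [sin (a h)], so this zero is all that orthogonality needs. *)
Lemma sin_halfperiod (k : int) : sin (2 * pi * (k%:~R * theta) * h) = 0.
Proof.
apply/eqP; rewrite -sqrf_eq0.
have [tn|tn] := leP 0 theta.
  have -> : 2 * pi * (k%:~R * theta) * h = 0 + k%:~R * pi.
    by rewrite /h ger0_norm//; field.
  by rewrite sqr_sinDpiz sin0 expr0n.
have -> : 2 * pi * (k%:~R * theta) * h = 0 + (- k)%:~R * pi.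
  by rewrite /h ltr0_norm// mulrNz; field.
by rewrite sqr_sinDpiz sin0 expr0n.
Qed.

Lemma Rintegral_cos_period (k : int) :
  \int[mu]_(t in I) cos (2 * pi * (k%:~R * theta) * t) =
  if k == 0 then `|theta|^-1 else 0.
Proof.
have hh : x - h < x + h by rewrite ltrD2l gtrN.
case: eqVneq => [->|k0].
  have -> : \int[mu]_(t in I) cos (2 * pi * (0%:~R * theta) * t) =
      \int[mu]_(t in I) 1.
    by apply: eq_Rintegral => t _; rewrite mul0r mulr0 mul0r cos0.
  rewrite Rintegral_cst; last exact: measurable_itv.
  have muI : mu I = (2 * h)%:E.
    by rewrite /I (lebesgue_measure_itv `[x - h, x + h]) /= lte_fin hh -EFinB; congr EFin; ring.
  rewrite mul1r -[LHS]/(fine (mu I)) muI /=.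
  by rewrite /h; field; rewrite normr_eq0.
set a := 2 * pi * (k%:~R * theta).
have a0 : a != 0.
  by rewrite !mulf_neq0 ?intr_eq0 ?pnatr_eq0//; exact: lt0r_neq0 (pi_gt0 R).
have dF (t : R) : is_derive t 1 (fun t => a^-1 * sin (a * t)) (cos (a * t)).
  apply: is_derive_eq; rewrite /GRing.scale/=; field.
  by rewrite a0.
have ccos : continuous (fun t : R => cos (a * t)).
  move=> t; apply: continuous_comp; last exact: continuous_cos.
  exact: mulrl_continuous.
rewrite /Rintegral (continuous_FTC2 (F := fun t => a^-1 * sin (a * t)) hh).
- rewrite -EFinB/= (mulrDr a) (mulrBr a) sinD sinB (sin_halfperiod k).
  by rewrite mulr0 addr0 subr0 subrr.
- by apply: continuous_subspaceT.
- have cF : continuous (fun t : R => a^-1 * sin (a * t)).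
    move=> t; apply: differentiable_continuous; apply/derivable1_diffP.
    by have [] := dF t.
  split.
  + by move=> t _; have [] := dF t.
  + by apply: cvg_at_right_filter; exact: cF.
  + by apply: cvg_at_left_filter; exact: cF.
- by move=> t _; rewrite derive1E; have [_ ->] := dF t.
Qed.

Lemma Rintegral_sin_period (k : int) :
  \int[mu]_(t in I) sin (2 * pi * (k%:~R * theta) * t) = 0.
Proof.
have hh : x - h < x + h by rewrite ltrD2l gtrN.
case: (eqVneq k 0) => [->|k0].
  have -> : \int[mu]_(t in I) sin (2 * pi * (0%:~R * theta) * t) =
      \int[mu]_(t in I) 0.
    by apply: eq_Rintegral => t _; rewrite mul0r mulr0 mul0r sin0.
  by rewrite Rintegral_cst ?mul0r//; exact: measurable_itv.
set a := 2 * pi * (k%:~R * theta).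
have a0 : a != 0.
  by rewrite !mulf_neq0 ?intr_eq0 ?pnatr_eq0//; exact: lt0r_neq0 (pi_gt0 R).
have dF (t : R) : is_derive t 1 (fun t => - a^-1 * cos (a * t)) (sin (a * t)).
  apply: is_derive_eq; rewrite /GRing.scale/=; field.
  by rewrite a0.
have csin : continuous (fun t : R => sin (a * t)).
  move=> t; apply: continuous_comp; last exact: continuous_sin.
  exact: mulrl_continuous.
rewrite /Rintegral (continuous_FTC2 (F := fun t => - a^-1 * cos (a * t)) hh).
- rewrite -EFinB/= (mulrDr a) (mulrBr a) cosD cosB (sin_halfperiod k).
  by rewrite mulr0 addr0 subr0 subrr.
- by apply: continuous_subspaceT.
- have cF : continuous (fun t : R => - a^-1 * cos (a * t)).
    move=> t; apply: differentiable_continuous; apply/derivable1_diffP.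
    by have [] := dF t.
  split.
  + by move=> t _; have [] := dF t.
  + by apply: cvg_at_right_filter; exact: cF.
  + by apply: cvg_at_left_filter; exact: cF.
- by move=> t _; rewrite derive1E; have [_ ->] := dF t.
Qed.

End OnePeriod.
End WindowedExponentials.

Section Moyal.
Context {R : realType}.
Local Notation mu := (@lebesgue_measure R).
Implicit Types (f g F E : L2fun R).

(* Up to conjugation by [F (t - x)], the shifts form an orthogonal system of
   windowed exponentials on an interval of length [1/|theta|]. *)
Lemma shift_bessel (theta : R) F E (C x kappa : R) (s : seq int) :
  theta != 0 -> uniq s ->
  (forall t, normc (val F t) <= C) ->
  (forall t, (2 * `|theta|)^-1 < `|t| -> val F t = 0) ->
  ((\sum_(n <- s) (L2form (shift x (kappa + n%:~R * theta) F) E ^+ 2 +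
     L2form ('i *: shift x (kappa + n%:~R * theta) F) E ^+ 2))%:E <=
  (`|theta|^-1)%:E *
    \int[mu]_t (normc (val E t) ^+ 2 * normc (val F (t - x)) ^+ 2)%:E)%E.
Proof.
move=> theta0 us FC Fsupp.
pose h := (2 * `|theta|)^-1.
pose I := `[x - h, x + h]%classic : set R.
(* With [psi] the conjugate of [F (t - x)], pairing the shift with [E] is the same as pairing
   [psi E] with the bare exponential; boundedness of [F] keeps [psi E] square integrable. *)
pose psi (t : R) : R[i] := (complex.Re (val F (t - x)) -i* complex.Im (val F (t - x)))%C.
have norm_psi t : normc (psi t) = normc (val F (t - x)).
  by rewrite /psi; case: (val F (t - x)) => a b /=; rewrite sqrrN.
have [|||u uE] := @L2_mul _ psi C E.
- by apply: (measurableT_comp (L2_measurable_Re F)); exact: measurable_translation.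
- apply: measurableT_comp => //.
  by apply: (measurableT_comp (L2_measurable_Im F)); exact: measurable_translation.
- by move=> t; rewrite norm_psi.
have -> : (\int[mu]_t (normc (val E t) ^+ 2 * normc (val F (t - x)) ^+ 2)%:E =
    (L2norm2 u)%:E)%E.
  rewrite L2norm2E; apply: eq_integral => t _.
  by rewrite uE normcM norm_psi exprMn mulrC.
rewrite -EFinM lee_fin.
pose om (n : int) := 2 * pi * (kappa + n%:~R * theta).
pose e n := sval (cid (L2_window (om n) (x - h) (x + h))).
have eE n t : val (e n) t = expi (om n * t) * (\1_I t)%:C%C.
  by rewrite /e; case: cid => /= w ->.
have outI t : t \notin I -> val F (t - x) = 0.
  move=> tI; apply: Fsupp; rewrite ltNge; apply: contra tI => tx.
  rewrite inE /I /= in_itv/=; move: tx; rewrite ler_norml -/h => /andP[? ?].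
  by apply/andP; split; lra.
have form1 n : L2form (shift x (kappa + n%:~R * theta) F) E = L2form u (e n).
  apply: eq_Rintegral => t _; rewrite uE eE.
  rewrite -[val (shift _ _ _) t]/(expi (om n * t) * val F (t - x)).
  have [tI|tI] := boolP (t \in I).
    rewrite indicE tI /psi; case: (val F _) (val E t) (expi _) => a b [c d] [p q].
    by rewrite /cdot/=; ring.
  rewrite /psi outI// indicE (negbTE tI) /cdot; case: (val E t) (expi _) => a b [c d].
  by rewrite /=; ring.
have form2 n : L2form ('i *: shift x (kappa + n%:~R * theta) F) E =
    L2form u ('i *: e n).
  apply: eq_Rintegral => t _.
  rewrite -[val ('i *: shift _ _ _) t]/('i * (expi (om n * t) * val F (t - x))).
  rewrite -[val ('i *: e n) t]/('i * val (e n) t) uE eE.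
  have [tI|tI] := boolP (t \in I).
    rewrite indicE tI /psi; case: (val F _) (val E t) (expi _) => a b [c d] [p q].
    by rewrite /cdot/=; ring.
  rewrite /psi outI// indicE (negbTE tI) /cdot; case: (val E t) (expi _) => a b [c d].
  by rewrite /=; ring.
have IE (H G : R -> R) : (forall t, t \in I -> H t = G t) ->
    (forall t, t \notin I -> H t = 0) -> \int[mu]_t H t = \int[mu]_(t in I) G t.
  move=> h1 h2; rewrite [RHS]Rintegral_mkcond; apply: eq_Rintegral => t _.
  by rewrite patchE; case: ifPn => tI; [rewrite h1|rewrite h2].
have ang n m t : om n * t - om m * t = 2 * pi * ((n - m)%:~R * theta) * t.
  by rewrite /om intrB; ring.
have ee n m : L2form (e n) (e m) = if n == m then `|theta|^-1 else 0.
  rewrite -(subr_eq0 n m) -(@Rintegral_cos_period _ theta x theta0) /L2form.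
  apply: IE => t tI; rewrite !eE indicE ?tI ?(negbTE tI).
    by rewrite -ang cosB /cdot/=; ring.
  by rewrite /cdot/=; ring.
have eie n m : L2form (e n) ('i *: e m) = 0.
  rewrite -(@Rintegral_sin_period _ theta x theta0 (n - m)) /L2form.
  apply: IE => t tI; rewrite -[val ('i *: e m) t]/('i * val (e m) t) !eE indicE
     ?tI ?(negbTE tI).
    by rewrite -ang sinB /cdot/=; ring.
  by rewrite /cdot/=; ring.
(* In the real form each complex exponential gives two orthogonal vectors, [e n] and ['i *: e n],
   both of squared norm [1 / |theta|]. *)
pose g (p : int * bool) := if p.2 then 'i *: e p.1 else e p.1.
have := form_orthogonal_bessel (s := [seq (n, b) | n <- s, b <- [:: false; true]])
  (g := g) L2form_psd u.
move=> /(_ (`|theta|^-1)) bes.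
apply: le_trans (bes _ _ _).
- rewrite big_allpairs/=; apply: ler_sum => n _.
  by rewrite !big_cons big_nil addr0 /g/= form1 form2.
- by rewrite allpairs_uniq// => -[? ?] [? ?].
- by rewrite invr_gt0 normr_gt0.
- move=> [n b] [m b'] _ _; rewrite /g/= xpair_eqE.
  case: b b' => -[]/=; rewrite ?andbT ?andbF ?L2form_i ?ee ?eie//.
  by rewrite (formC L2form_psd) eie.
Qed.

Lemma normc2_ge0 f t : (0 <= (normc (val f t) ^+ 2)%:E :> \bar R)%E.
Proof. by rewrite lee_fin sqr_ge0. Qed.

Lemma integral_normc2_addl E (t : R) :
  (\int[mu]_x (normc (val E (t + x)) ^+ 2)%:E = (L2norm2 E)%:E)%E.
Proof.
rewrite L2norm2E.
rewrite -[RHS](ge0_integral_translation (- t) (h := fun t => (normc (val E t) ^+ 2)%:E)).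
- by apply: eq_integral => x _; rewrite opprK addrC.
- by apply/measurable_EFinP; exact: L2_measurable_normc2.
- exact: normc2_ge0.
Qed.

Section Correlation.
Variables E F : L2fun R.

Let G (p : measurableTypeR R * measurableTypeR R) : \bar R :=
  (normc (val E (p.2 + p.1)) ^+ 2 * normc (val F p.2) ^+ 2)%:E.

Let mG : measurable_fun setT G.
Proof.
have mE := L2_measurable_normc2 E; have mF := L2_measurable_normc2 F.
apply/measurable_EFinP; apply: measurable_funM.
  apply: (measurableT_comp mE).
  apply: measurable_funD; [exact: measurable_snd|exact: measurable_fst].
by apply: (measurableT_comp mF); exact: measurable_snd.
Qed.

Let G0 p : (0 <= G p)%E.
Proof. by rewrite lee_fin mulr_ge0 ?sqr_ge0. Qed.

Let GE (x : R) :
  (\int[mu]_t (normc (val E t) ^+ 2 * normc (val F (t - x)) ^+ 2)%:E =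
   \int[mu]_t G (x, t))%E.
Proof.
have mE := L2_measurable_normc2 E; have mF := L2_measurable_normc2 F.
rewrite -[RHS](ge0_integral_translation x
  (h := fun t => (normc (val E (t + x)) ^+ 2 * normc (val F t) ^+ 2)%:E)).
- by apply: eq_integral => t _; rewrite subrK.
- apply/measurable_EFinP; apply: measurable_funM => //.
  apply: (measurableT_comp mE); have := measurable_translation (- x).
  by under eq_fun do rewrite opprK.
- by move=> t; rewrite lee_fin mulr_ge0 ?sqr_ge0.
Qed.

Lemma measurable_correlation : measurable_fun setT (fun x : R =>
  (\int[mu]_t (normc (val E t) ^+ 2 * normc (val F (t - x)) ^+ 2)%:E)%E).
Proof.
under eq_fun do rewrite GE.
exact: (@measurable_fun_fubini_tonelli_F _ _ _ _ _ mu G mG G0).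
Qed.

(** After the substitution of [t + x] for [t], the variable [x] occurs only in [E]; integrating in
    [x] first then gives [L2norm2 E] for every [t]. *)
Lemma integral_correlation :
  (\int[mu]_x \int[mu]_t (normc (val E t) ^+ 2 * normc (val F (t - x)) ^+ 2)%:E =
    (L2norm2 E * L2norm2 F)%:E)%E.
Proof.
have mE := L2_measurable_normc2 E; have mF := L2_measurable_normc2 F.
under eq_integral do rewrite GE.
rewrite (@fubini_tonelli _ _ _ _ _ mu mu G mG G0).
transitivity (\int[mu]_t ((L2norm2 E)%:E * (normc (val F t) ^+ 2)%:E))%E.
  apply: eq_integral => t _; rewrite /G/=.
  under eq_integral do rewrite mulrC EFinM.
  rewrite ge0_integralZl//.
  - by rewrite integral_normc2_addl muleC.
  - apply/measurable_EFinP; apply: (measurableT_comp mE).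
    have := measurable_translation (- t).
    by under eq_fun do rewrite opprK addrC.
  - by move=> x _; rewrite lee_fin sqr_ge0.
  - exact: normc2_ge0.
rewrite ge0_integralZl// ?lee_fin ?L2norm2_ge0//.
- by rewrite -L2norm2E EFinM.
- by apply/measurable_EFinP.
- by move=> t _; exact: normc2_ge0.
Qed.

End Correlation.
End Moyal.

(** * Truncation and strong continuity *)

Section StrongContinuity.
Context {R : realType}.
Local Notation mu := (@lebesgue_measure R).
Implicit Types (F G : L2fun R).

(** Since [t - x] may leave the segment, uniform continuity on it is not enough; joint continuity in
    [(t, x)] is combined with compactness in [t]. *)
Lemma continuous_translation_uniform (g : R -> R) (a b e : R) :
  continuous g -> 0 < e ->
  exists2 d : R, 0 < d & forall x t, `|x| < d -> a <= t <= b ->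
    `|g (t - x) - g t| <= e.
Proof.
move=> cg e0.
have := @segment_compact R a b; rewrite compact_near_coveringP.
move=> /(_ R (nbhs (0 : R)) (fun x t => `|g (t - x) - g t| <= e) _) [].
  move=> t _.
  have h : (fun p : R * R => g (p.1 - p.2) - g p.1) q @[q --> (t, 0 : R)] --> (0 : R).
    rewrite [X in _ --> X](_ : 0 = g (t - 0) - g t); last by rewrite subr0 subrr.
    apply: cvgB.
      apply: continuous_cvg; first exact: cg.
      by apply: cvgB; [exact: cvg_fst|exact: cvg_snd].
    by apply: continuous_cvg; [exact: cg|exact: cvg_fst].
  have /cvgrPdist_le/(_ e e0) := h.
  by apply: filterS => -[t' x] /=; rewrite sub0r normrN.
move=> d /= d0 hd; exists d => // x t xd tab.
apply: hd => /=; last by rewrite in_itv.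
by rewrite sub0r normrN.
Qed.

Lemma L1_translation_continuous (u : R -> R) (C h e : R) :
  measurable_fun setT u -> (forall t, `|u t| <= C) ->
  (forall t, h < `|t| -> u t = 0) -> 0 < e ->
  exists2 d : R, 0 < d & forall x, `|x| < d ->
    (\int[mu]_t `|u (t - x) - u t|%:E <= e%:E)%E.
Proof.
move=> mu_ uC uh e0.
(* For [|x| < 1] and [t] in [E1], both [t] and [t - x] lie in [E], where [u] is approximated; for
   [t] outside [E1], both values of [u] vanish. *)
pose E := `[- (`|h| + 2), `|h| + 2]%classic : set R.
pose E1 := `[- (`|h| + 1), `|h| + 1]%classic : set R.
have mE : measurable E by exact: measurable_itv.
have mE1 : measurable E1 by exact: measurable_itv.
have h0 := normr_ge0 h.
have muE : mu E = (2 * (`|h| + 2))%:E.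
  rewrite /E (lebesgue_measure_itv `[- (`|h| + 2), `|h| + 2])/= lte_fin.
  by rewrite ifT -?EFinB; [congr EFin; ring|lra].
have muE1 : mu E1 = (2 * (`|h| + 1))%:E.
  rewrite /E1 (lebesgue_measure_itv `[- (`|h| + 1), `|h| + 1])/= lte_fin.
  by rewrite ifT -?EFinB; [congr EFin; ring|lra].
have muEfin : (mu E < +oo)%E by rewrite muE ltry.
have iu : mu.-integrable E (EFin \o u).
  apply: measurable_bounded_integrable => //.
  - exact: measurable_funTS.
  - by exists C; split; rewrite ?num_real// => x Cx t _ /=; apply: (le_trans (uC t)); exact: ltW.
have [g_ [cg ig gu]] := approximation_continuous_integrable mE muEfin iu.
have e4 : 0 < e / 4 by rewrite divr_gt0.
have /fine_cvgP[_ /cvgrPdist_lt/(_ _ e4) gu'] := gu.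
have [fin _] := (fine_cvgP _ _).1 gu.
have [N hN finN] : exists2 N, fine (\int[mu]_(z in E) `|(u z - g_ N z)%:E|)%E < e / 4 &
    (\int[mu]_(z in E) `|(u z - g_ N z)%:E|)%E \is a fin_num.
  near \oo => N; exists N; last by near: N; exact: fin.
  have : `|0 - fine (\int[mu]_(z in E) `|(u z - g_ N z)%:E|)%E| < e / 4.
    by near: N; exact: gu'.
  by rewrite sub0r normrN; apply: le_lt_trans; exact: ler_norm.
pose g := g_ N.
pose psi (t : R) : R := \1_E t * `|u t - g t|.
have mg : measurable_fun setT g by apply: continuous_measurable_fun; exact: cg.
have mpsi : measurable_fun setT psi.
  apply: measurable_funM; first exact: measurable_indic.
  by apply: measurableT_comp => //; apply: measurable_funB.
have psi0 t : 0 <= psi t by rewrite mulr_ge0.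
have Ipsi : (\int[mu]_t (psi t)%:E <= (e / 4)%:E)%E.
  have -> : (\int[mu]_t (psi t)%:E = \int[mu]_(z in E) `|(u z - g z)%:E|)%E.
    rewrite [RHS]integral_mkcond; apply: eq_integral => t _.
    by rewrite patchE /psi indicE; case: ifP => _; rewrite ?mul1r ?mul0r.
  by rewrite -(fineK finN) lee_fin ltW.
(* [E1] has measure [2 (|h| + 1)], so [eta] contributes [e / 4], as does each of the two
   approximation errors. *)
pose eta := e / (8 * (`|h| + 1)).
have eta0 : 0 < eta by rewrite divr_gt0// mulr_gt0// ltr_wpDl.
have [d d0 hd] := @continuous_translation_uniform g (- (`|h| + 1)) (`|h| + 1) eta (cg N) eta0.
exists (Num.min d 1); first by rewrite lt_min d0 ltr01.
move=> x; rewrite lt_min => /andP[xd x1].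
have mpsix : measurable_fun setT (fun t : R => psi (t - x)).
  by apply: (measurableT_comp mpsi); exact: measurable_translation.
have bound t : `|u (t - x) - u t| <= psi (t - x) + psi t + eta * \1_E1 t.
  have hle := ler_norm h.
  have [tE|tE] := boolP (t \in E1); last first.
    have ht : `|h| + 1 < `|t|.
      rewrite ltNge; apply: contra tE; rewrite ler_norml => ?.
      by rewrite inE /E1/= in_itv.
    have htx : `|h| < `|t - x|.
      by have := ler_normB (t - x) (- x); rewrite opprK subrK normrN; lra.
    rewrite !uh ?subrr ?normr0 ?addr_ge0 ?mulr_ge0 ?(ltW eta0)//; lra.
  have t1 : - (`|h| + 1) <= t <= `|h| + 1.
    by move: tE; rewrite inE /E1/= in_itv.
  rewrite /psi !indicE tE mulr1.
  have inE_ y : `|y| <= `|h| + 2 -> y \in E.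
    by rewrite ler_norml inE /E/= in_itv.
  have -> : t \in E by apply: inE_; rewrite ler_norml; apply/andP; split; lra.
  have -> : t - x \in E.
    apply: inE_; move: x1 t1; rewrite ltr_norml ler_norml => /andP[? ?] /andP[? ?].
    by apply/andP; split; lra.
  rewrite !mul1r; have := hd _ _ xd t1.
  have := ler_normD (u (t - x) - g (t - x)) (g (t - x) - g t + (g t - u t)).
  have := ler_normD (g (t - x) - g t) (g t - u t).
  rewrite (distrC (g t) (u t)).
  rewrite (_ : u (t - x) - g (t - x) + (g (t - x) - g t + (g t - u t)) =
    u (t - x) - u t); last by ring.
  lra.
have mind : measurable_fun setT (fun t : R => eta * \1_E1 t).
  by apply: measurable_funM; [exact: measurable_cst|exact: measurable_indic].
apply: (@le_trans _ _ (\int[mu]_t ((psi (t - x))%:E + (psi t)%:E + (eta * \1_E1 t)%:E))%E).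
  apply: ge0_le_integral => //.
  - apply/measurable_EFinP; apply: measurableT_comp => //.
    apply: measurable_funB => //.
    by apply: (measurableT_comp mu_); exact: measurable_translation.
  - apply: emeasurable_funD; first apply: emeasurable_funD;
      exact/measurable_EFinP.
  - by move=> t _; rewrite -!EFinD lee_fin.
have p0 (f : R -> R) : (forall t, 0 <= f t) -> forall t : R, setT t -> (0 <= (f t)%:E)%E.
  by move=> f0 t _; rewrite lee_fin.
rewrite ge0_integralD//; last 4 first.
- by move=> t _; rewrite -EFinD lee_fin addr_ge0.
- by apply: emeasurable_funD; exact/measurable_EFinP.
- by move=> t _; rewrite lee_fin mulr_ge0// ltW.
- exact/measurable_EFinP.
rewrite ge0_integralD//; last 4 first.
- by move=> t _; rewrite lee_fin.
- exact/measurable_EFinP.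
- by move=> t _; rewrite lee_fin.
- exact/measurable_EFinP.
rewrite (ge0_integral_translation x (h := fun t => (psi t)%:E)); last 2 first.
- exact/measurable_EFinP.
- by move=> t; rewrite lee_fin.
have -> : (\int[mu]_t (eta * \1_E1 t)%:E = (e / 4)%:E)%E.
  under eq_integral do rewrite EFinM.
  have mi : measurable_fun setT (fun t : R => (\1_E1 t : R)%:E).
    by apply/measurable_EFinP; exact: measurable_indic.
  have i0 (t : R) : setT t -> (0 <= (\1_E1 t : R)%:E)%E by rewrite lee_fin.
  rewrite ge0_integralZl// ?lee_fin ?(ltW eta0)// integral_indic//.
  transitivity (eta%:E * mu E1)%E; first by congr (_ * mu _)%E; exact: setIT.
  by rewrite muE1 -EFinM /eta; congr EFin; field; rewrite gt_eqF// ltr_wpDl.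
have -> : e%:E = ((e / 4)%:E + (e / 4)%:E + (e / 4)%:E + (e / 4)%:E)%E.
  by rewrite -!EFinD; congr EFin; field.
apply: (@le_trans _ _ ((e / 4)%:E + (e / 4)%:E + (e / 4)%:E)%E).
  by rewrite !leeD.
by rewrite -!EFinD lee_fin lerDl ltW.
Unshelve. all: by end_near.
Qed.

End StrongContinuity.

Section Truncation.
Context {R : realType}.
Local Notation mu := (@lebesgue_measure R).
Implicit Types (F G : L2fun R).

Lemma measurable_normr_le (c : R) (u : R -> R) : measurable_fun setT u ->
  measurable [set t : R | u t <= c].
Proof.
move=> m; rewrite -[X in measurable X]setTI.
have -> : [set t : R | u t <= c] = u @^-1` `]-oo, c]%classic.
  by apply/seteqP; split => t /=; rewrite in_itv.
exact: m.
Qed.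

Lemma L2_truncate F (e : R) : 0 < e -> exists G (C h : R),
  [/\ forall t, normc (val G t) <= C, forall t, h < `|t| -> val G t = 0 &
      L2norm2 (F - G) <= e].
Proof.
move=> e0.
pose A (n : nat) := [set t : R | normc (val F t) ^+ 2 <= n%:R] `&`
  [set t : R | `|t| <= n%:R].
have mA n : measurable (A n).
  by apply: measurableI; apply: measurable_normr_le => //;
    exact: L2_measurable_normc2.
have ex n : exists G, forall t, val G t = (\1_(A n) t)%:C%C * val F t.
  have [||t|G hG] := @L2_mul _ (fun t => (\1_(A n) t)%:C%C) 1 F.
  - exact: measurable_indic.
  - exact: measurable_cst.
  - rewrite /= expr0n addr0 sqrtr_sqr indicE.
    by case: (_ \in _); rewrite ?normr1 ?normr0.
  - by exists G.
pose G n := sval (cid (ex n)).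
have GE n t : val (G n) t = (\1_(A n) t)%:C%C * val F t.
  by rewrite /G; case: cid.
pose f_ (n : nat) (t : R) : \bar R := (normc (val (F - G n) t) ^+ 2)%:E.
pose f (t : R) : \bar R := (normc (val F t) ^+ 2)%:E.
have subE n t : val (F - G n) t = if t \in A n then 0 else val F t.
  rewrite -[LHS]/(val F t - val (G n) t) GE indicE.
  by case: ifP => _; rewrite ?mul1r ?subrr ?mul0r ?subr0.
have mf_ n : measurable_fun setT (f_ n).
  by apply/measurable_EFinP; exact: L2_measurable_normc2.
have [||||_ _] := @dominated_convergence _ _ _ mu setT measurableT f_ (cst 0%E) f mf_.
- exact: measurable_cst.
- apply: aeW => t _.
  pose N := (Num.truncn (normc (val F t) ^+ 2 + `|t|)).+1.
  have hN : normc (val F t) ^+ 2 + `|t| < N%:R by exact: Num.Theory.truncnS_gt.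
  apply: cvg_near_cst; exists N => // n /= Nn.
  rewrite /f_ subE ifT ?normc0 ?expr0n//.
  have {}Nn : N%:R <= n%:R :> R by rewrite ler_nat.
  have n1 := normr_ge0 t; have n2 := sqr_ge0 (normc (val F t)).
  by rewrite inE; split => /=; lra.
- exact: L2_integrable.
- apply: aeW => t n _; rewrite /f_ /f gee0_abs ?lee_fin ?sqr_ge0// subE.
  by case: ifP => _; rewrite ?normc0 ?expr0n ?sqr_ge0.
rewrite integral0 => /fine_cvgP[_ /cvgrPdist_le/(_ e e0)[N _ hN]].
have := hN N (leqnn N); rewrite sub0r normrN /= -L2norm2E /= => h.
(* On [A N] only the square of the modulus is at most [N]; [N + 1] bounds the modulus itself. *)
exists (G N), N.+1%:R, N%:R; split.
- move=> t; rewrite GE indicE normcM; case: (boolP (t \in A N)) => [|_]; last first.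
    by rewrite normc0 mul0r.
  rewrite inE => -[/= h1 _].
  rewrite /= expr0n addr0 sqrtr_sqr normr1.
  rewrite mul1r leNgt; apply/negP => h2.
  have : N.+1%:R ^+ 2 <= N%:R :> R.
    apply: le_trans h1; rewrite lerXn2r ?nnegrE ?(ltW h2)//.
    by apply: le_trans (ltW h2).
  rewrite -natrX ler_nat -mulnn mulSn; lia.
- move=> t ht; rewrite GE indicE memNset ?mul0r// => -[_ /=].
  by rewrite leNgt ht.
- by apply: le_trans h; exact: ler_norm.
Qed.

Lemma normc2_sub (z w : R[i]) : normc (z - w) ^+ 2 =
  (complex.Re z - complex.Re w) ^+ 2 + (complex.Im z - complex.Im w) ^+ 2.
Proof. by rewrite normc2E; case: z w => [a b] [c d]. Qed.

Lemma le_Re_normc (z : R[i]) : `|complex.Re z| <= normc z.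
Proof.
rewrite -ler_sqr ?nnegrE ?normr_ge0//; last by case: z => ? ?; exact: sqrtr_ge0.
by rewrite real_normK ?num_real// normc2E lerDl sqr_ge0.
Qed.

Lemma le_Im_normc (z : R[i]) : `|complex.Im z| <= normc z.
Proof.
rewrite -ler_sqr ?nnegrE ?normr_ge0//; last by case: z => ? ?; exact: sqrtr_ge0.
by rewrite real_normK ?num_real// normc2E lerDr sqr_ge0.
Qed.

(** For values bounded by [C], [(a - b)^2 <= (2 C + 1) |a - b|], which reduces the claim to L1
    continuity of the real and imaginary parts. The summand 1 keeps the factor positive when
    [C = 0]. *)
Lemma translation_continuous F (C h e : R) :
  (forall t, normc (val F t) <= C) -> (forall t, h < `|t| -> val F t = 0) ->
  0 < e -> exists2 d : R, 0 < d & forall x, `|x| < d ->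
    L2norm2 (translation_fun x F - F) <= e.
Proof.
move=> FC Fh e0.
pose u t := complex.Re (val F t); pose v t := complex.Im (val F t).
have uC t : `|u t| <= C by exact: le_trans (le_Re_normc _) (FC t).
have vC t : `|v t| <= C by exact: le_trans (le_Im_normc _) (FC t).
have uh t : h < `|t| -> u t = 0 by move=> /Fh; rewrite /u => ->.
have vh t : h < `|t| -> v t = 0 by move=> /Fh; rewrite /v => ->.
have C0 : 0 <= C by apply: le_trans (uC 0).
pose k := 2 * C + 1; have k0 : 0 < k by rewrite ltr_wpDl ?mulr_ge0.
have e1 : 0 < e / (2 * k) by rewrite divr_gt0// mulr_gt0.
have mu_ := L2_measurable_Re F; have mv := L2_measurable_Im F.
have [d1 d10 h1] := L1_translation_continuous mu_ uC uh e1.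
have [d2 d20 h2] := L1_translation_continuous mv vC vh e1.
exists (Num.min d1 d2); first by rewrite lt_min d10.
move=> x; rewrite lt_min => /andP[xd1 xd2].
rewrite -lee_fin L2norm2E.
have mx := measurable_translation x.
have mdu (w : R -> R) : measurable_fun setT w ->
    measurable_fun setT (fun t : R => `|w (t - x) - w t|%:E).
  move=> mw; apply/measurable_EFinP; apply: measurableT_comp => //.
  apply: measurable_funB => //.
  by apply: (measurableT_comp mw).
have sq (a b : R) : `|a| <= C -> `|b| <= C -> (a - b) ^+ 2 <= k * `|a - b|.
  move=> aC bC; rewrite -(real_normK (num_real (a - b))) expr2.
  by rewrite ler_wpM2r//; have := ler_normB a b; rewrite /k; lra.
apply: (@le_trans _ _ (\int[mu]_t (k%:E * (`|u (t - x) - u t|%:E + `|v (t - x) - v t|%:E)))%E).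
  apply: ge0_le_integral => //.
  - by move=> t _; rewrite lee_fin sqr_ge0.
  - by apply/measurable_EFinP; exact: L2_measurable_normc2.
  - apply: emeasurable_funM; first exact: measurable_cst.
    by apply: emeasurable_funD; exact: mdu.
  - move=> t _; rewrite -EFinD -EFinM lee_fin.
    rewrite -[val _ t]/(val F (t - x) - val F t) normc2_sub mulrDr.
    by apply: lerD; [exact: sq (uC _) (uC _)|exact: sq (vC _) (vC _)].
have n0 (w : R -> R) : forall t : R, setT t -> (0 <= `|w (t - x) - w t|%:E)%E.
  by move=> t _; rewrite lee_fin.
have md := emeasurable_funD (mdu _ mu_) (mdu _ mv).
have nd (t : R) : setT t -> (0 <= `|u (t - x) - u t|%:E + `|v (t - x) - v t|%:E)%E.
  by move=> _; rewrite -EFinD lee_fin addr_ge0.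
rewrite ge0_integralZl// ?lee_fin ?(ltW k0)//.
have mdu_ := mdu _ mu_; have mdv := mdu _ mv; have nu := n0 u; have nv := n0 v.
rewrite ge0_integralD//.
apply: (@le_trans _ _ (k%:E * ((e / (2 * k))%:E + (e / (2 * k))%:E))%E).
  apply: lee_wpmul2l; first by rewrite lee_fin ltW.
  by apply: leeD; [exact: h1|exact: h2].
by rewrite -EFinD -EFinM lee_fin le_eqVlt; apply/orP; left; apply/eqP; field;
  rewrite gt_eqF.
Qed.

Lemma normc2_expiB1 (a : R) : normc (expi a - 1) ^+ 2 = 2 - 2 * cos a.
Proof.
rewrite normc2_sub /= subr0; have := cos2Dsin2 a.
by rewrite !expr2; lra.
Qed.

(** On the bounded support the angle [2 pi w t] is uniformly small, so the factor
    [2 - 2 cos (2 pi w t)] comes out of the integral. *)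
Lemma modulation_continuous F (h e : R) :
  (forall t, h < `|t| -> val F t = 0) ->
  0 < e -> exists2 d : R, 0 < d & forall w, `|w| < d ->
    L2norm2 (modulation_fun w F - F) <= e.
Proof.
move=> Fh e0.
have q0 : 0 < L2norm2 F + 1 by rewrite ltr_wpDl ?L2norm2_ge0.
pose e1 := e / (L2norm2 F + 1); have e10 : 0 < e1 by rewrite divr_gt0.
have : 2 - 2 * cos x @[x --> (0 : R)] --> (0 : R).
  rewrite [X in _ --> X](_ : 0 = 2 - 2 * cos 0); last by rewrite cos0 mulr1 subrr.
  apply: cvgB; first exact: cvg_cst.
  by apply: cvgM; [exact: cvg_cst|exact: continuous_cos].
move=> /cvgrPdist_le/(_ e1 e10)[d /= d0 hd].
have p0 := pi_gt0 R.
have hp : 0 < 2 * pi * (`|h| + 1) by rewrite !mulr_gt0// ltr_wpDl.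
exists (d / (2 * pi * (`|h| + 1))); first by rewrite divr_gt0.
move=> w; rewrite ltr_pdivlMr// => wd.
rewrite -lee_fin L2norm2E.
have mF : measurable_fun setT (fun t : R => (normc (val F t) ^+ 2)%:E).
  by apply/measurable_EFinP; exact: L2_measurable_normc2.
have n0 : forall t : R, setT t -> (0 <= (normc (val F t) ^+ 2)%:E)%E.
  by move=> t _; rewrite lee_fin sqr_ge0.
apply: (@le_trans _ _ (\int[mu]_t (e1%:E * (normc (val F t) ^+ 2)%:E))%E).
  apply: ge0_le_integral => //.
  - by move=> t _; rewrite lee_fin sqr_ge0.
  - by apply/measurable_EFinP; exact: L2_measurable_normc2.
  - by apply: emeasurable_funM; first exact: measurable_cst.
  - move=> t _; rewrite -EFinM lee_fin.
    rewrite -[val _ t]/(expi (2 * pi * w * t) * val F t - val F t).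
    rewrite -[X in _ - X]mul1r -mulrBl normcM exprMn normc2_expiB1.
    have [ht|ht] := ltP h `|t|; first by rewrite Fh// normc0 expr0n !mulr0.
    rewrite ler_wpM2r ?sqr_ge0//.
    have := hd (2 * pi * w * t); rewrite /= sub0r normrN => H.
    have {}H : `|0 - (2 - 2 * cos (2 * pi * w * t))| <= e1.
      apply: H; apply: le_lt_trans wd.
      rewrite !normrM (ger0_norm (ltW p0)) (ger0_norm (ler0n _ 2)).
      rewrite mulrCA -mulrA [leRHS]mulrCA -!mulrA.
      rewrite [leLHS](_ : _ = 2 * pi * `|w| * `|t|); last by ring.
      rewrite [leRHS](_ : _ = 2 * pi * `|w| * (`|h| + 1)); last by ring.
      rewrite ler_wpM2l ?mulr_ge0 ?(ltW p0)//.
      by apply: (le_trans ht); apply: (le_trans (ler_norm h)); rewrite lerDl.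
    by apply: le_trans H; rewrite sub0r normrN; exact: ler_norm.
rewrite ge0_integralZl// ?lee_fin ?(ltW e10)// -L2norm2E -EFinM lee_fin.
by rewrite /e1 -mulrA ger_pMr// mulrC ler_pdivrMr// mul1r lerDl.
Qed.

Lemma shift_continuous F (e : R) : 0 < e -> exists2 d : R, 0 < d &
  forall x w, `|x| < d -> `|w| < d -> L2norm2 (shift x w F - F) <= e.
Proof.
(* With 24, [step] costs [e / 6] and the final splitting [2 (2 e / 24 + 2 e / 6) + 2 e / 24 = 11 e /
   12]. *)
move=> e0; have e12 : 0 < e / 24 by rewrite divr_gt0.
have [G [C [h [GC Gh GF]]]] := L2_truncate F e12.
have [d1 d10 h1] := translation_continuous GC Gh e12.
have [d2 d20 h2] := modulation_continuous Gh e12.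
exists (Num.min d1 d2); first by rewrite lt_min d10.
move=> x w; rewrite !lt_min => /andP[xd _] /andP[_ wd].
have step : L2norm2 (shift x w G - G) <= e / 6.
  have -> : shift x w G - G =
      shift 0 w (translation_fun x G - G) + (modulation_fun w G - G).
    rewrite shiftB addrA; congr (_ - _); rewrite -addrA.
    have -> : modulation_fun w G = shift 0 w G.
      apply: val_inj; apply/funext => t.
      by rewrite -[RHS]/(expi (2 * pi * w * t) * val G (t - 0)) subr0.
    rewrite addNr addr0; apply: val_inj; apply/funext => t.
    rewrite -[RHS]/(expi (2 * pi * w * t) * val G (t - 0 - x)).
    by rewrite subr0.
  apply: le_trans (L2norm2D _ _) _; rewrite L2norm2_shift.
  have := h1 _ xd; have := h2 _ wd.
  set p := L2norm2 (translation_fun x G - G).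
  by set q := L2norm2 (modulation_fun w G - G); move: p q => p q; lra.
have -> : shift x w F - F = shift x w (F - G) + (shift x w G - G) - (F - G).
  by rewrite shiftB opprB (addrA (shift x w F - _)) subrK addrA subrK.
apply: le_trans (L2norm2B _ _) _.
have := L2norm2D (shift x w (F - G)) (shift x w G - G).
rewrite L2norm2_shift; move: step GF.
set p := L2norm2 (F - G); set q := L2norm2 (shift x w G - G).
by set r := L2norm2 (_ + _); move: p q r => p q r; lra.
Qed.

End Truncation.

(** * Counting dimensions *)

Section DimensionBound.
Context {R : realType}.
Local Notation mu := (@lebesgue_measure R).
Implicit Types (E F : L2fun R).

(* For a fixed translation [x] the time-frequency shifts with frequencies
   [kappa x + n theta] are controlled by Bessel's inequality for the Fourier
   series on an interval of length [1/|theta|]; integrating in [x] turns the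
   trace of the orthogonal projection on the span of [L] into its dimension. *)
Lemma dimension_bound (I : finType) (xs : I -> R) (n : I -> int)
    (theta kappa l eps C : R) F (L : seq (L2fun R)) :
  theta != 0 -> 0 <= l ->
  (forall t, normc (val F t) <= C) ->
  (forall t, (2 * `|theta|)^-1 < `|t| -> val F t = 0) ->
  (forall i j x, n i = n j -> xs i <= x < xs i + l -> xs j <= x < xs j + l ->
    i = j) ->
  (forall i x, xs i <= x < xs i + l ->
    exists2 w, in_span (@L2form R) L w &
      L2norm2 (shift x (kappa * x + (n i)%:~R * theta) F - w) <= eps) ->
  #|I|%:R * l * (L2norm2 F - eps) <= `|theta|^-1 * (size L)%:R * L2norm2 F.
Proof.
move=> theta0 l0 FC Fsupp disj near.
have ti0 : 0 <= `|theta|^-1 by rewrite invr_ge0.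
have [qe|qe] := ltP (L2norm2 F) eps.
  apply: (@le_trans _ _ 0).
    by rewrite mulr_ge0_le0 ?mulr_ge0 ?subr_le0 ?(ltW qe).
  by rewrite !mulr_ge0 ?L2norm2_ge0.
have [e [se e1 eL]] := span_bessel L2form_psd L2form_i L.
pose J i := `[xs i, xs i + l[%classic : set R.
pose corr E x := (\int[mu]_t
  (normc (val E t) ^+ 2 * normc (val F (t - x)) ^+ 2)%:E)%E.
(* The 2 comes from testing [u] and ['i *: u]; it cancels against the [2 * size L] vectors of
   [e]. *)
pose k := 2 * (L2norm2 F - eps).
have k0 : 0 <= k by rewrite mulr_ge0 ?subr_ge0.
have corr0 E x : (0 <= corr E x)%E.
  by apply: integral_ge0 => t _; rewrite lee_fin mulr_ge0 ?sqr_ge0.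
have pointwise x : (\sum_(i : I) (k * \1_(J i) x)%:E <=
    \sum_(v <- e) (`|theta|^-1)%:E * corr v x)%E.
  pose s := [seq i <- enum I | x \in J i].
  have -> : (\sum_(i : I) (k * \1_(J i) x)%:E = (\sum_(i <- s) k)%:E)%E.
    rewrite sumEFin; congr EFin; rewrite big_filter -big_enum/= [in RHS]big_mkcond.
    by apply: eq_bigr => i _; rewrite indicE; case: ifP; rewrite ?mulr1 ?mulr0.
  have inJ i : i \in s -> xs i <= x < xs i + l.
    by rewrite mem_filter => /andP[/set_mem]; rewrite /J/= in_itv.
  (* Indices active at the same [x] have distinct frequencies by [disj], so one Bessel inequality
     covers them all. *)
  have us : uniq [seq n i | i <- s].
    rewrite map_inj_in_uniq => [|i j si sj nij].
      by apply: filter_uniq; exact: enum_uniq.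
    exact: disj nij (inJ _ si) (inJ _ sj).
  pose term v m := L2form (shift x (kappa * x + m%:~R * theta) F) v ^+ 2 +
     L2form ('i *: shift x (kappa * x + m%:~R * theta) F) v ^+ 2.
  apply: (@le_trans _ _ (\sum_(v <- e) (\sum_(m <- [seq n i | i <- s]) term v m)%:E)%E).
    rewrite sumEFin lee_fin.
    under [leRHS]eq_bigr do rewrite big_map.
    rewrite exchange_big/= !big_seq; apply: ler_sum => i si.
    have [w wL wF] := near i x (inJ _ si).
    have := eL _ _ _ wL wF; rewrite -/(L2norm2 _) L2norm2_shift.
    by [].
  rewrite !big_seq; apply: lee_sum => v _.
  exact: shift_bessel theta0 us FC Fsupp.
have mJ i : measurable (J i) by exact: measurable_itv.
have muJ i : mu (J i) = l%:E.
  rewrite /J (lebesgue_measure_itv `[xs i, xs i + l[)/= lte_fin ltrDl.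
  case: ltP => [_|l1]; first by rewrite -EFinB addrAC subrr add0r.
  by congr EFin; apply/eqP; rewrite eq_le l0 l1.
have mcorr E : measurable_fun setT (fun x : R => (`|theta|^-1)%:E * corr E x)%E.
  by apply: emeasurable_funM; [exact: measurable_cst|exact: measurable_correlation].
have mind i : measurable_fun setT (fun x : R => (k * \1_(J i) x)%:E).
  apply/measurable_EFinP; apply: measurable_funM; first exact: measurable_cst.
  exact: measurable_indic.
have tot : (\int[mu]_x \sum_(i : I) (k * \1_(J i) x)%:E <=
    \int[mu]_x \sum_(v <- e) (`|theta|^-1)%:E * corr v x)%E.
  apply: ge0_le_integral => //.
  - move=> x _; apply: sume_ge0 => i _; rewrite lee_fin mulr_ge0//.
  - by apply: emeasurable_sum.
  - by apply: emeasurable_sum.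
move: tot; rewrite ge0_integral_sum//; last first.
  by move=> i x _; rewrite lee_fin mulr_ge0.
rewrite ge0_integral_sum//; last first.
  by move=> v x _; rewrite mule_ge0.
have iind i : (\int[mu]_x (k * \1_(J i) x)%:E = (k * l)%:E)%E.
  under eq_integral do rewrite EFinM.
  have mi : measurable_fun setT (fun x : R => (\1_(J i) x : R)%:E).
    by apply/measurable_EFinP; exact: measurable_indic.
  have i0 (x : R) : setT x -> (0 <= (\1_(J i) x : R)%:E)%E by rewrite lee_fin.
  rewrite ge0_integralZl// ?lee_fin// integral_indic//.
    transitivity (k%:E * mu (J i))%E; last by rewrite muJ EFinM.
    by congr (_ * mu _)%E; exact: setIT.
  exact: mJ.
have icorr v : (\int[mu]_x ((`|theta|^-1)%:E * corr v x) =
    (`|theta|^-1 * (L2norm2 v * L2norm2 F))%:E)%E.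
  have mc : measurable_fun setT (corr v) by exact: measurable_correlation.
  have c0 (x : R) : setT x -> (0 <= corr v x)%E by [].
  by rewrite ge0_integralZl// ?lee_fin// integral_correlation.
under eq_bigr do rewrite iind.
under [leRHS]eq_bigr do rewrite icorr.
rewrite !sumEFin lee_fin.
have -> : \sum_(i : I) k * l = 2 * (#|I|%:R * l * (L2norm2 F - eps)).
  by rewrite sumr_const -mulr_natl /k; ring.
have : \sum_(v <- e) `|theta|^-1 * (L2norm2 v * L2norm2 F) <=
    (size L).*2%:R * (`|theta|^-1 * L2norm2 F).
  rewrite -se -sum1_size natr_sum mulr_suml !big_seq; apply: ler_sum => v ve.
  by rewrite mul1r ler_wpM2l// ler_piMl ?L2norm2_ge0//; exact: e1.
move=> h1 h2; have := le_trans h2 h1.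
rewrite -mul2n natrM.
have -> : 2 * (size L)%:R * (`|theta|^-1 * L2norm2 F) =
  2 * (`|theta|^-1 * (size L)%:R * L2norm2 F) by ring.
by rewrite ler_pM2l.
Qed.

End DimensionBound.

(** * Spans of lattice shifts and the two counting arguments *)

Section LatticeSpans.
Context {R : realType}.
Implicit Types (F u : L2fun R) (L : seq (L2fun R)).

Notation span := (in_span (@L2form R)).

Lemma span_shift L L' x w u :
  {in L, forall v, span L' (shift x w v)} -> span L u -> span L' (shift x w u).
Proof.
move=> h Lu; apply: (Lu (fun u => span L' (shift x w u))) => //.
  by move=> c v v' hv hv'; rewrite shift_lin; exact: in_span_lin.
move=> v v0; apply: in_span_null.
by rewrite -/(L2norm2 _) L2norm2_shift.
Qed.

Lemma shift_split x w y v F : shift (x + y) (w + v) F =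
  expi (2 * pi * v * x) *: shift x w (shift y v F).
Proof. by rewrite shift_comp scalerA expiNr scale1r. Qed.

Lemma span_shift_split L x w y v F :
  span L (shift x w (shift y v F)) <-> span L (shift (x + y) (w + v) F).
Proof.
split => h; first by rewrite shift_split; apply: (in_spanZ L2form_psd).
by rewrite shift_comp; apply: (in_spanZ L2form_psd).
Qed.

Lemma span_solve L (c : R[i]) u v : c != 0 ->
  L2norm2 (c *: u + v) = 0 -> span L v -> span L u.
Proof.
move=> c0 h Lv.
have -> : u = c^-1 *: ((c *: u + v) + (-1) *: v).
  by rewrite scaleN1r addrK scalerA mulVf// scale1r.
apply: (in_spanZ L2form_psd); apply: (in_spanD); first exact: in_span_null.
exact: (in_spanZ L2form_psd).
Qed.

(** The link between the two functions: the spans consist of shifts of [F], the tested vectors are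
    shifts of its truncation [G]. *)
Lemma near_shift F G (e d : R) L x w y v :
  L2norm2 (F - G) <= e ->
  (forall x w, `|x| < d -> `|w| < d -> L2norm2 (shift x w F - F) <= e) ->
  `|y| < d -> `|v| < d -> span L (shift x w F) ->
  exists2 u, span L u & L2norm2 (shift (x + y) (w + v) G - u) <= 4 * e.
Proof.
move=> FG Fd yd vd LF.
exists (expi (2 * pi * v * x) *: shift x w F).
  exact: (in_spanZ L2form_psd).
rewrite shift_split -scalerBr -shiftB L2norm2_Z normc_expi expr1n mul1r.
rewrite L2norm2_shift.
have -> : shift y v G - F = (shift y v F - F) - shift y v (F - G).
  by rewrite shiftB opprB addrCA addrAC subrr add0r.
apply: le_trans (L2norm2B _ _) _; rewrite L2norm2_shift.
have := Fd _ _ yd vd; move: FG.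
by move: (L2norm2 (_ - _)) (L2norm2 (_ - _)) => p q; lra.
Qed.

Section Lattice.
Variables (a1 a2 b1 b2 : R) (F : L2fun R).
Let D := a1 * b2 - b1 * a2.
Hypothesis a1_neq0 : a1 != 0.

Definition lattice_shift (j l : int) : L2fun R :=
  shift (j%:~R * a1 + l%:~R * b1) (j%:~R * a2 + l%:~R * b2) F.

(** Transported by a shift, the relation replaces a step along [nu] by no step, a step along [a] or
    a step along [b]. So [k] steps enlarge the lattice square by [k] in each direction. *)
Lemma span_orbit (r s : R) :
  span [:: F; shift a1 a2 F; shift b1 b2 F]
    (shift (r * a1 + s * b1) (r * a2 + s * b2) F) ->
  forall (k : nat) (j l : int) L,
  (forall j' l' : nat, (j' <= k)%N -> (l' <= k)%N ->
     span L (lattice_shift (j + j') (l + l'))) ->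
  span L (shift (j%:~R * a1 + l%:~R * b1 + k%:R * (r * a1 + s * b1))
                (j%:~R * a2 + l%:~R * b2 + k%:R * (r * a2 + s * b2)) F).
Proof.
move=> nuF; elim => [|k IH] j l L hL.
  have := hL 0%N 0%N isT isT; rewrite !addr0 !mul0r !addr0; exact.
have kS (p q t : R) : p + q + k.+1%:R * t = p + q + k%:R * t + t.
  by rewrite -natr1 mulrDl mul1r addrA.
rewrite !kS.
apply/span_shift_split; apply: span_shift nuF => v.
rewrite !inE => /or3P[] /eqP ->.
- by apply: IH => j' l' hj hl; apply: hL; exact: leqW.
- apply/span_shift_split.
  have e (p q t : R) : j%:~R * p + q + t + p = (j + 1)%:~R * p + q + t.
    by rewrite intrD; ring.
  rewrite !e; apply: IH => j' l' hj hl; rewrite -addrA -[1]/(1%:Z) -PoszD add1n.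
  by apply: hL => //; exact: leqW.
- apply/span_shift_split.
  have e (p q t : R) : q + l%:~R * p + t + p = q + (l + 1)%:~R * p + t.
    by rewrite intrD; ring.
  rewrite !e; apply: IH => j' l' hj hl.
  rewrite -[l + 1 + _]addrA -[1]/(1%:Z) -PoszD add1n.
  by apply: hL => //; exact: leqW.
Qed.

(** Each step along [b] is traded for at most one step along [a]; an [n] by [n] block thus collapses
    into a row of length [2n]. *)
Lemma span_row :
  span [:: F; shift a1 a2 F] (shift b1 b2 F) ->
  forall (n : nat) (j : int) L,
  (forall j' : nat, (j' <= n)%N -> span L (lattice_shift (j + j') 0)) ->
  span L (lattice_shift j n).
Proof.
move=> bF; elim => [|n IH] j L hL.
  by have := hL 0%N isT; rewrite addr0.
rewrite /lattice_shift.
have nS (x y : R) : x + n.+1%:~R * y = x + n%:~R * y + y.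
  by rewrite -addn1 PoszD intrD mulrDl mul1r addrA.
rewrite !nS.
apply/span_shift_split; apply: span_shift bF => v.
rewrite !inE => /orP[] /eqP ->.
  by apply: IH => j' hj; apply: hL; exact: leqW.
apply/span_shift_split.
have e (p q : R) : j%:~R * p + q + p = (j + 1)%:~R * p + q.
  by rewrite intrD; ring.
rewrite !e; apply: IH => j' hj; rewrite -addrA -[1]/(1%:Z) -PoszD add1n.
exact: hL.
Qed.

(** The line through [v b] parallel to [a] is the graph of [kappa x + v s0] over the translation
    axis, so consecutive lattice rows are [s0] apart in frequency. *)
Let s0 := D / a1.
Let kappa := a2 / a1.

Let slope (u v x : R) : x = u * a1 + v * b1 ->
  u * a2 + v * b2 = kappa * x + v * s0.
Proof. by move=> ->; rewrite /kappa /s0 /D; field. Qed.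

Hypothesis D0 : D != 0.

Let s00 : s0 != 0.
Proof. by rewrite mulf_neq0// invr_eq0. Qed.

(** Inserting [k - 1] lines between consecutive lattice rows widens the Bessel window [1 / |theta|]
    until it contains the support of the truncation. *)
Let frequency_step (h : R) : exists k : nat,
  [/\ (0 < k)%N, s0 / k%:R != 0, h <= (2 * `|s0 / k%:R|)^-1 &
      `|s0 / k%:R|^-1 = k%:R * `|a1| / `|D|].
Proof.
pose k := (Num.truncn (2 * `|s0| * `|h|)).+1; exists k.
have hk : 2 * `|s0| * `|h| < k%:R by exact: Num.Theory.truncnS_gt.
have k0 : 0 < k%:R :> R by rewrite ltr0n.
have s0p : 0 < `|s0| by rewrite normr_gt0.
split => //.
- by rewrite mulf_neq0// invr_eq0 gt_eqF.
- rewrite normrM normfV (ger0_norm (ltW k0)).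
  have -> : (2 * (`|s0| / k%:R))^-1 = k%:R / (2 * `|s0|).
    by field; rewrite !gt_eqF.
  rewrite ler_pdivlMr ?mulr_gt0//.
  have := ler_norm h; rewrite -(ler_pM2l s0p) => ?.
  have -> : h * (2 * `|s0|) = 2 * (`|s0| * h) by ring.
  rewrite -mulrA in hk; lra.
- rewrite normrM normfV (ger0_norm (ltW k0)) /s0 normrM normfV.
  by field; rewrite !normr_eq0 a1_neq0 D0 gt_eqF.
Qed.

Hypothesis F0 : 0 < L2norm2 F.

Let norm_truncated G (e : R) : L2norm2 (F - G) <= e ->
  L2norm2 F <= 2 * e + 2 * L2norm2 G.
Proof.
move=> h; rewrite -[in X in X <= _](subrK G F).
by apply: le_trans (L2norm2D _ _) _; rewrite lerD2r ler_pM2l.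
Qed.

(* At every lattice point starts a segment of slope [kappa] and fixed length on
   which the shifts of a truncation of [F] stay close to the span of [L]. *)
Lemma lattice_rank : exists K : R, forall (n : nat) L,
  (forall j l : nat, (j < n)%N -> (l < n)%N -> span L (lattice_shift j l)) ->
  n%:R ^+ 2 <= K * (size L)%:R.
Proof.
(* Truncation leaves [L2norm2 G] at least [19/40] of [L2norm2 F], well above the error [4 * e]. *)
pose e := L2norm2 F / 40; have e0 : 0 < e by rewrite divr_gt0.
have [G [C [h [GC Gh GF]]]] := L2_truncate F e0.
have [d d0 hd] := shift_continuous F e0.
have [k [k0 th0 hk ek]] := frequency_step h.
(* The bound [|a1|] keeps the segments of one row disjoint; the other keeps both coordinates of a
   displacement along the slope [kappa] below [d]. *)
pose l := Num.min (`|a1|) (d / (`|kappa| + 1)).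
have kp : 0 < `|kappa| + 1 by rewrite ltr_wpDl.
have l0 : 0 < l by rewrite lt_min normr_gt0 a1_neq0 divr_gt0.
have la : l <= `|a1| by rewrite ge_min lexx.
have ld : l * (`|kappa| + 1) <= d by rewrite -ler_pdivlMr// ge_min lexx orbT.
have qG : 0 < L2norm2 G - 4 * e.
  move: (norm_truncated GF) F0; rewrite /e.
  by move: (L2norm2 F) (L2norm2 G) => p q; lra.
exists (`|s0 / k%:R|^-1 * L2norm2 G / (l * (L2norm2 G - 4 * e))) => n L hL.
have := @dimension_bound R ('I_n * 'I_n)%type
  (fun p => p.1%:R * a1 + p.2%:R * b1) (fun p => (p.2 * k)%N%:Z)
  (s0 / k%:R) kappa l (4 * e) C G L th0 (ltW l0) GC.
have Gsupp t : (2 * `|s0 / k%:R|)^-1 < `|t| -> val G t = 0.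
  by move=> ht; apply: Gh; exact: le_lt_trans ht.
move=> /(_ Gsupp) bnd.
have {bnd} : #|{: 'I_n * 'I_n}|%:R * l * (L2norm2 G - 4 * e) <=
    `|s0 / k%:R|^-1 * (size L)%:R * L2norm2 G.
  apply: bnd.
  - move=> [j i] [j' i'] x nn.
    have ii' : i = i'.
      by apply/val_inj/eqP; rewrite -(eqn_pmul2r k0); case: nn => /= ->.
    rewrite -{}ii' /= => /andP[x1 x2] /andP[x3 x4]; congr (_, _); apply/val_inj/eqP.
    have : `|(j%:R - j'%:R) * a1| < `|a1|.
      by apply: lt_le_trans la; rewrite ltr_norml; apply/andP; split; lra.
    rewrite normrM gtr_pMl ?normr_gt0// ltr_norml => /andP[x5 x6].
    rewrite eqn_leq; apply/andP; split; rewrite -ltnS -(ltr_nat R) /=.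
      by rewrite (_ : (val j').+1%:R = j'%:R + 1 :> R); [lra|rewrite natr1].
    by rewrite (_ : (val j).+1%:R = j%:R + 1 :> R); [lra|rewrite natr1].
  - move=> [j i] x /= /andP[x1 x2].
    pose t := x - (j%:R * a1 + i%:R * b1).
    have t0 : 0 <= t by rewrite subr_ge0.
    have tl : t < l by rewrite ltrBlDl.
    have -> : x = (j%:R * a1 + i%:R * b1) + t by rewrite /t addrC subrK.
    have -> : kappa * (j%:R * a1 + i%:R * b1 + t) + (i * k)%N%:~R * (s0 / k%:R) =
       j%:R * a2 + i%:R * b2 + kappa * t.
      rewrite -[(i * k)%N%:~R]/((i * k)%N%:R) natrM (slope erefl).
      by field; rewrite pnatr_eq0 -lt0n.
    have k0' := normr_ge0 kappa.
    have lkd : l * `|kappa| <= d - l by move: ld; rewrite mulrDr mulr1; lra.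
    apply: near_shift GF hd _ _ (hL j i (ltn_ord j) (ltn_ord i)).
      by rewrite ger0_norm//; have := mulr_ge0 (ltW l0) k0'; lra.
    rewrite normrM (ger0_norm t0).
    have : `|kappa| * t <= `|kappa| * l by rewrite ler_wpM2l// ltW.
    by rewrite (mulrC _ l); lra.
rewrite card_prod card_ord natrM -expr2 => h1.
rewrite mulrAC ler_pdivlMr ?mulr_gt0//.
by rewrite mulrA [leRHS]mulrAC.
Qed.

Lemma le_of_quadratic_growth (x y A B : R) : 0 <= y -> 0 <= A -> 0 <= B ->
  (forall p : nat, p%:R ^+ 2 * x <= (p%:R + A) * (p%:R + B) * y) -> x <= y.
Proof.
move=> y0 A0 B0 hp; rewrite leNgt; apply/negP => yx.
have xy : 0 < x - y by rewrite subr_gt0.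
(* For [p >= 1] the lower-order terms [(A + B) p + A B] are at most [(A + B + A B) p], and [p] is
   taken beyond the resulting crossing point. *)
pose c := (A + B + A * B) * y.
pose p := (Num.truncn (c / (x - y))).+1.
have cp : c / (x - y) < p%:R by exact: Num.Theory.truncnS_gt.
rewrite ltr_pdivrMr// in cp.
have p1 : 1 <= p%:R :> R by rewrite -[1]/(1%:R) ler_nat.
have := hp p; move: cp p1; rewrite /c.
move: (p%:R) => P cp P1 h.
have : P * ((A + B + A * B) * y) < P * (P * (x - y)).
  by rewrite ltr_pM2l// (lt_le_trans ltr01).
have : A * B * y <= P * (A * B * y).
  by rewrite ler_peMl// !mulr_ge0.
have -> : P * ((A + B + A * B) * y) =
  P * A * y + P * B * y + P * (A * B * y) by ring.
have e1 : (P + A) * (P + B) * y = P * P * y + P * A * y + P * B * y + A * B * y.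
  by ring.
have -> : P * (P * (x - y)) = P * P * x - P * P * y by ring.
rewrite e1 expr2 in h.
move: h; move: (P * P * x) (P * P * y) (P * A * y) (P * B * y) (A * B * y).
by move=> ? ? ? ? z; move: (P * z) => ? *; lra.
Qed.

(** The region has sides parallel to the frequency axis, so each row [l] has its own start in [j]:
    with [t = b1 / a1] the translation coordinate is [(j + l t) a1]. The count [p + 2 M' + 2] leaves
    room for the floor. *)
Let lattice_rect (t : R) (p M M' : nat) : seq (L2fun R) :=
  [seq lattice_shift (Num.floor (- M'%:R - (l%:Z - M%:Z)%:~R * t) + i%:Z)
     (l%:Z - M%:Z) | l <- iota 0 (p + M.*2.+1), i <- iota 0 (p + M'.*2.+2)].

Let mem_lattice_rect (t : R) (p M M' : nat) (j l : int) :
  - (M%:R : R) <= (l%:~R : R) <= p%:R + M%:R ->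
  - (M'%:R : R) <= (j%:~R + l%:~R * t : R) <= p%:R + M'%:R ->
  lattice_shift j l \in lattice_rect t p M M'.
Proof.
move=> /andP[l1 l2] /andP[j1 j2].
have : (0 <= l + M%:Z)%R.
  by rewrite -(ler_int R) intrD -[(M%:Z)%:~R]/(M%:R); lra.
move eL : (l + M%:Z) => [l'|//] _.
have lE : l = l'%:Z - M%:Z by rewrite -eL addrK.
pose f := Num.floor (- M'%:R - l%:~R * t).
have /andP[f1 f2] := Num.Theory.floor_itv (- M'%:R - l%:~R * t).
rewrite -/f in f1 f2; rewrite intrD in f2.
have : (0 <= j - f)%R.
  by rewrite -(ler_int R) intrB; lra.
move eJ : (j - f) => [j'|//] _.
have jE : j = f + j'%:Z by rewrite -eJ addrC subrK.
apply/allpairsP; exists (l', j'); rewrite !mem_iota /= !add0n -lE -/f -jE; split=> //.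
  rewrite -(ltr_nat R) natrD -natr1 -mul2n natrM.
  have : l'%:R = l%:~R + M%:R :> R by rewrite lE intrB subrK.
  by move=> ->; lra.
rewrite -(ltr_nat R) natrD -addn2 natrD -mul2n natrM.
have : j'%:R = j%:~R - f%:~R :> R by rewrite jE intrD addrAC subrr add0r.
by move=> ->; lra.
Qed.

(* The shifts of [F] along [lattice + k nu], [k <= K], lie in the span of the
   nearby lattice shifts and are dense, so a parallelogram of area [p^2 |D|] is
   captured by about [p^2] lattice vectors. *)
Lemma dense_orbit_bound (r s : R) :
  (forall d : R, 0 < d -> exists K : nat, forall u v : R,
     exists m : nat, exists j l : int,
     [/\ (m <= K)%N, `|u - j%:~R - m%:R * r| < d &
         `|v - l%:~R - m%:R * s| < d]) ->
  span [:: F; shift a1 a2 F; shift b1 b2 F]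
    (shift (r * a1 + s * b1) (r * a2 + s * b2) F) ->
  `|D| <= 1.
Proof.
move=> kron nuF; rewrite leNgt; apply/negP => D1.
have Dp : 0 < `|D| by rewrite normr_gt0.
(* [rho] is the relative slack in [|D| > 1]; taking [e] proportional to it lets the strict
   inequality survive truncation in [qG]. *)
pose rho := 1 - `|D|^-1.
have rho0 : 0 < rho by rewrite subr_gt0 invf_lt1.
have rho1 : rho < 1 by rewrite ltrBlDl ltrDr invr_gt0.
pose e := rho * L2norm2 F / 40.
have e0 : 0 < e by rewrite divr_gt0// mulr_gt0.
have [G [C [h [GC Gh GF]]]] := L2_truncate F e0.
have [d d0 hd] := shift_continuous F e0.
have [k [k0 th0 hk ek]] := frequency_step h.
have qG : L2norm2 G < `|D| * (L2norm2 G - 4 * e).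
  rewrite -ltr_pdivrMl//.
  have -> : `|D|^-1 * L2norm2 G = L2norm2 G - rho * L2norm2 G.
    by rewrite /rho; ring.
  have := norm_truncated GF; move: F0; rewrite /e.
  move: (L2norm2 F) (L2norm2 G) => q q' q0 qq'.
  have : rho * q <= q by rewrite ger_pMl// ltW.
  have : rho * q <= rho * (2 * (rho * q / 40) + 2 * q') by rewrite ler_pM2l.
  have : rho * (rho * q) <= rho * q by rewrite ler_pM2l// ger_pMl// ltW.
  have : 0 < rho * q by rewrite mulr_gt0.
  rewrite mulrDr; have -> : rho * (2 * (rho * q / 40)) = rho * (rho * q) / 20 by field.
  have -> : rho * (2 * q') = 2 * (rho * q') by ring.
  move: (rho * (rho * q)) (rho * q') (rho * q) => *; lra.
have Gsupp t : (2 * `|s0 / k%:R|)^-1 < `|t| -> val G t = 0.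
  by move=> ht; apply: Gh; exact: le_lt_trans ht.
(* [S] converts errors in the coordinates along [a] and [b] into displacements in the plane;
   [d' <= 1] keeps these errors within the margins [M] and [M']. *)
pose S := `|a1| + `|b1| + `|a2| + `|b2| + 1.
have S0 : 0 < S by rewrite ltr_wpDl// !addr_ge0.
pose d' := Num.min 1 (d / S).
have d'0 : 0 < d' by rewrite lt_min ltr01 divr_gt0.
have d'1 : d' <= 1 by rewrite ge_min lexx.
have d'S : d' * S <= d by rewrite -ler_pdivlMr// ge_min lexx orbT.
have [K hK] := kron _ d'0.
pose t := b1 / a1.
(* At most [K] steps along [nu] change the coordinates by [K |r|] and [K |s|], the lattice square
   adds [K], the Kronecker error adds 1. In [M'] the shear adds [M |t|]. *)
pose M := (Num.truncn (K%:R * `|s| + K%:R + 1)).+1.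
have hM : K%:R * `|s| + K%:R + 1 < M%:R by exact: Num.Theory.truncnS_gt.
pose M' := (Num.truncn (K%:R * `|r| + K%:R + 1 + M%:R * `|t|)).+1.
have hM' : K%:R * `|r| + K%:R + 1 + M%:R * `|t| < M'%:R.
  exact: Num.Theory.truncnS_gt.
suff : `|D| * (L2norm2 G - 4 * e) <= L2norm2 G by rewrite leNgt qG.
apply: (@le_of_quadratic_growth _ _ (M.*2.+1%:R) (M'.*2.+2%:R)) => //.
  exact: L2norm2_ge0.
move=> p.
(* The interval of length [p |a1|] from [x0] corresponds to [x / a1] between 0 and [p] for either
   sign of [a1]. *)
pose x0 := Num.min 0 (p%:R * a1).
have bnd := @dimension_bound R 'I_(p * k) (fun=> x0) (fun i => (i : nat)%:Z)
  (s0 / k%:R) kappa (p%:R * `|a1|) (4 * e) C G (lattice_rect t p M M')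
  th0 _ GC Gsupp.
have {bnd} : (p * k)%:R * (p%:R * `|a1|) * (L2norm2 G - 4 * e) <=
   `|s0 / k%:R|^-1 * ((p + M.*2.+1) * (p + M'.*2.+2))%:R * L2norm2 G.
  have p0 : 0 <= p%:R * `|a1| by rewrite mulr_ge0.
  move: bnd => /(_ p0).
  rewrite card_ord /lattice_rect size_allpairs !size_iota; apply.
    by move=> i j x [] ij _ _; exact: val_inj.
  move=> i x /andP[x1 x2].
  set y := x / a1; have yE : x = y * a1 by rewrite /y divfK.
  have /andP[y0 yp] : 0 <= y <= p%:R.
    have pp : 0 <= p%:R :> R by [].
    move: x1 x2; rewrite /x0 yE; have [a1n|a1p|a1z] := ltrgt0P a1.
    - have pa : 0 <= p%:R * a1 by rewrite mulr_ge0 ?(ltW a1n).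
      rewrite (min_idPl pa) add0r => x1 x2.
      by rewrite -(pmulr_lge0 _ a1n) x1 -(ler_pM2r a1n) ltW.
    - have pa : p%:R * a1 <= 0 by rewrite mulr_ge0_le0 ?(ltW a1p).
      rewrite (min_idPr pa) mulrN subrr => x1 x2.
      by rewrite -(nmulr_lle0 _ a1p) ltW// -(ler_nM2r a1p).
    - by move: a1_neq0; rewrite a1z eqxx.
  have kp : 0 < k%:R :> R by rewrite ltr0n.
  pose v : R := i%:R / k%:R.
  have v0 : 0 <= v by rewrite divr_ge0.
  have vp : v <= p%:R.
    by rewrite ler_pdivrMr// -natrM ler_nat ltnW.
  pose u := y - v * t.
  have xE : x = u * a1 + v * b1 by rewrite yE /u /t; field.
  have [m [j [l [mK]]]] := hK u v.
  set al := u - _ - _; set be := v - _ - _ => al_lt be_lt.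
  have ex : x = (j%:~R * a1 + l%:~R * b1 + m%:R * (r * a1 + s * b1)) +
      (al * a1 + be * b1) by rewrite xE /al /be; ring.
  have ew : kappa * x + (i : nat)%:~R * (s0 / k%:R) =
      (j%:~R * a2 + l%:~R * b2 + m%:R * (r * a2 + s * b2)) +
      (al * a2 + be * b2).
    transitivity (kappa * x + v * s0).
      by rewrite /v -[(i : nat)%:~R]/((i : nat)%:R); field; rewrite gt_eqF.
    by rewrite -(slope xE) /al /be; ring.
  have small (p1 p2 : R) : `|p1| + `|p2| + 1 <= S -> `|al * p1 + be * p2| < d.
    move=> hS; apply: lt_le_trans d'S; apply: le_lt_trans (ler_normD _ _) _.
    rewrite !normrM.
    have : d' * (`|p1| + `|p2| + 1) <= d' * S by rewrite ler_pM2l.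
    have : `|al| * `|p1| <= d' * `|p1| by rewrite ler_wpM2r// ltW.
    have : `|be| * `|p2| <= d' * `|p2| by rewrite ler_wpM2r// ltW.
    rewrite !mulrDr mulr1; lra.
  rewrite ew [in shift x]ex.
  apply: near_shift GF hd _ _ _.
  - apply: small; rewrite /S; have := normr_ge0 a2; have := normr_ge0 b2; lra.
  - apply: small; rewrite /S; have := normr_ge0 a1; have := normr_ge0 b1; lra.
  apply: (span_orbit nuF) => j' l' j'm l'm.
  apply: in_span_mem; apply: mem_lattice_rect.
  - have mK' : m%:R <= K%:R :> R by rewrite ler_nat.
    have l'K : l'%:R <= K%:R :> R by rewrite ler_nat (leq_trans l'm).
    have l'0 : 0 <= l'%:R :> R by [].
    have ms : `|m%:R * s| <= K%:R * `|s|.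
      by rewrite normrM ger0_norm// ler_wpM2r.
    have lE : l%:~R = v - m%:R * s - be by rewrite /be; ring.
    have be1 : `|be| <= 1 by apply: ltW; exact: lt_le_trans be_lt d'1.
    rewrite intrD -[l'%:~R]/(l'%:R) lE.
    move: ms be1; rewrite !ler_norml => /andP[ms1 ms2] /andP[be1 be2].
    have K0 : 0 <= K%:R :> R by [].
    by apply/andP; split; lra.
  - have mK' : m%:R <= K%:R :> R by rewrite ler_nat.
    have l'K : l'%:R <= K%:R :> R by rewrite ler_nat (leq_trans l'm).
    have j'K : j'%:R <= K%:R :> R by rewrite ler_nat (leq_trans j'm).
    have l'0 : 0 <= l'%:R :> R by [].
    have j'0 : 0 <= j'%:R :> R by [].
    have K0 : 0 <= K%:R :> R by [].
    have mr : `|m%:R * r| <= K%:R * `|r|.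
      by rewrite normrM ger0_norm// ler_wpM2r.
    have ms : `|m%:R * s| <= K%:R * `|s|.
      by rewrite normrM ger0_norm// ler_wpM2r.
    have al1 : `|al| <= 1 by apply: ltW; exact: lt_le_trans al_lt d'1.
    have be1 : `|be| <= 1 by apply: ltW; exact: lt_le_trans be_lt d'1.
    have tM : `|(l'%:R - m%:R * s - be) * t| <= M%:R * `|t|.
      rewrite normrM ler_wpM2r// ler_norml.
      move: ms be1; rewrite !ler_norml => /andP[ms1 ms2] /andP[be1 be2].
      by apply/andP; split; lra.
    rewrite !intrD -[l'%:~R]/(l'%:R) -[j'%:~R]/(j'%:R).
    have -> : j%:~R + j'%:R + (l%:~R + l'%:R) * t =
        y + (j'%:R - m%:R * r - al + (l'%:R - m%:R * s - be) * t).
      by rewrite /al /be /u; ring.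
    move: mr al1 tM; move: (_ * t) (m%:R * r) => z z'.
    rewrite !ler_norml => /andP[? ?] /andP[? ?] /andP[? ?].
    by apply/andP; split; lra.
move=> h1.
have c0 : 0 < k%:R * `|a1| / `|D|.
  by rewrite divr_gt0// mulr_gt0 ?ltr0n// normr_gt0.
rewrite -(ler_pM2l c0); move: h1; rewrite ek => h1.
have -> : k%:R * `|a1| / `|D| * (p%:R ^+ 2 * (`|D| * (L2norm2 G - 4 * e))) =
  (p * k)%:R * (p%:R * `|a1|) * (L2norm2 G - 4 * e).
  by rewrite natrM; field; rewrite gt_eqF.
by apply: (le_trans h1); rewrite natrM !natrD !mulrA.
Qed.

End Lattice.
End LatticeSpans.

(** * Linear independence of three and of four shifts *)

Lemma three_point_independent (R : realType) (a1 a2 b1 b2 : R) (F : L2fun R) :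
  a1 * b2 - b1 * a2 != 0 -> 0 < L2norm2 F ->
  ~ in_span (@L2form R) [:: F; shift a1 a2 F] (shift b1 b2 F).
Proof.
move=> D0 F0 bF.
pose L n := [seq lattice_shift a1 a2 b1 b2 F j%:Z 0 | j <- iota 0 n.*2].
have sL n : size (L n) = n.*2 by rewrite size_map size_iota.
have LL n (j l : nat) : (j < n)%N -> (l < n)%N ->
    in_span (@L2form R) (L n) (lattice_shift a1 a2 b1 b2 F j l).
  move=> jn ln; apply: span_row bF _ _ _ _ => j' j'l.
  apply: in_span_mem; apply/mapP; exists (j + j')%N => //.
  by rewrite mem_iota /= add0n; lia.
have [K hK] : exists K : R, forall n : nat, n%:R ^+ 2 <= K * (n.*2)%:R.
  (* Slopes require a nonzero translation coordinate. If [a1 = 0], then [D0] gives [b1 != 0], and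
     the square block of lattice points is symmetric in the two generators. *)
  have [a0|a0] := eqVneq a1 0; last first.
    have [K hK] := @lattice_rank R a1 a2 b1 b2 F a0 D0 F0; exists K => n.
    by rewrite -sL; apply: hK => j l; exact: LL.
  have b0 : b1 != 0.
    by apply: contraNneq D0 => ->; rewrite a0 !mul0r subrr.
  have D0' : b1 * a2 - a1 * b2 != 0 by rewrite -oppr_eq0 opprB.
  have [K hK] := @lattice_rank R b1 b2 a1 a2 F b0 D0' F0; exists K => n.
  rewrite -sL; apply: hK => j l jn ln.
  have -> : lattice_shift b1 b2 a1 a2 F j l = lattice_shift a1 a2 b1 b2 F l j.
    by rewrite /lattice_shift addrC [X in shift _ X]addrC.
  exact: LL.
pose n := (Num.truncn (2 * `|K|)).+1.
have hn : 2 * `|K| < n%:R by exact: Num.Theory.truncnS_gt.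
have n0 : 0 < n%:R :> R by rewrite ltr0n.
have := hK n; rewrite -mul2n natrM expr2 mulrA ler_pM2r//.
have := ler_norm K; lra.
Qed.

Lemma tfshift_repr (R : realType) (f : L2 R) (z : 'rV[R]_2) :
  tfshift z f = \pi_(L2 R) (shift (z 0 0) (z 0 1) (repr f)).
Proof. by rewrite -[in LHS](reprK f) tfshift_pi. Qed.

Theorem theorem2p1 (R : realType) (a b : 'rV[R]_2) (r s : R) (nu : 'rV[R]_2)
    (f : L2 R) :
  free [:: a; b] ->
  nu = r *: a + s *: b ->
  f != 0 ->
  1 < `|symplectic a b| ->
  rat_independent [tuple 1; r; s] ->
  linearly_independent [tuple f; tfshift a f; tfshift b f; tfshift nu f].
Proof.
move=> _ nuE f0 D1 rs c.
pose F := repr f.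
pose c0 := c ord0; pose c1 := c (lift ord0 ord0).
pose c2 := c (lift ord0 (lift ord0 ord0)).
pose c3 := c (lift ord0 (lift ord0 (lift ord0 ord0))).
rewrite !big_ord_recl big_ord0 addr0 !(tnth_nth 0)/= -/c0 -/c1 -/c2 -/c3.
pose a1 := a 0 0; pose a2 := a 0 1; pose b1 := b 0 0; pose b2 := b 0 1.
have zero (G : L2fun R) : \pi_(L2 R) G = 0 <-> L2norm2 G = 0.
  rewrite L2norm2_eq0 -[0 in X in X <-> _](raddf0 \pi_(L2 R)).
  exact: L2_eqP.
have F0 : 0 < L2norm2 F.
  rewrite lt_neqAle L2norm2_ge0 andbT eq_sym; apply: contra f0 => /eqP F0.
  by apply/eqP; rewrite -(reprK f); apply/zero.
have D0 : a1 * b2 - b1 * a2 != 0.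
  by rewrite -normr_gt0; apply: lt_trans D1.
rewrite -[X in c0 *: X](reprK f) !tfshift_repr -/F -!pi_L2Z -!raddfD.
move=> /zero; rewrite -/a1 -/a2 -/b1 -/b2.
have -> : nu 0 0 = r * a1 + s * b1 by rewrite nuE !mxE.
have -> : nu 0 1 = r * a2 + s * b2 by rewrite nuE !mxE.
move=> rel.
have LZ := in_spanZ L2form_psd; have LD := @in_spanD _ _ (@L2form R).
have c3_0 : c3 = 0.
  apply/eqP; apply: contraT => c3n.
  have nuF : in_span (@L2form R) [:: F; shift a1 a2 F; shift b1 b2 F]
      (shift (r * a1 + s * b1) (r * a2 + s * b2) F).
    move: rel; rewrite !addrA addrC => /(span_solve c3n); apply.
    apply: (LD); first apply: (LD); apply: (LZ); apply: in_span_mem; rewrite !inE eqxx ?orbT//.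
  have kr d : 0 < d -> _ := @kronecker2 R r s d rs.
  have [a0|a0] := eqVneq a1 0; last first.
    by have := dense_orbit_bound a0 D0 F0 kr nuF; rewrite leNgt D1.
  have b0 : b1 != 0.
    by apply: contraNneq D0 => ->; rewrite a0 !mul0r subrr.
  have D0' : b1 * a2 - a1 * b2 != 0 by rewrite -oppr_eq0 opprB.
  have nuF' : in_span (@L2form R) [:: F; shift b1 b2 F; shift a1 a2 F]
      (shift (s * b1 + r * a1) (s * b2 + r * a2) F).
    rewrite (addrC (s * b1)) (addrC (s * b2)); apply: in_span_trans nuF => v vL.
    by apply: in_span_mem; move: vL; rewrite !inE orbCA orbC -orbA.
  (* Exchanging the generators also exchanges [r] and [s]; Kronecker's statement is then used with
     its two targets swapped. *)
  have := @dense_orbit_bound R b1 b2 a1 a2 F b0 D0' F0 s r _ nuF'.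
  rewrite -opprB normrN leNgt D1 => h; suff : false by [].
  apply: h => d d0; have [K hK] := kr d d0; exists K => u v.
  by have [m [j [l [h1 h2 h3]]]] := hK v u; exists m, l, j.
rewrite c3_0 scale0r addr0 in rel.
have c2_0 : c2 = 0.
  apply/eqP; apply: contraT => c2n.
  case: (three_point_independent D0 F0).
  move: rel; rewrite addrA addrC => /(span_solve c2n); apply.
  by apply: (LD); apply: (LZ); apply: in_span_mem; rewrite !inE eqxx ?orbT.
rewrite c2_0 scale0r addr0 in rel.
have c1_0 : c1 = 0.
  apply/eqP; apply: contraT => c1n.
  have D0' : b1 * a2 - a1 * b2 != 0 by rewrite -oppr_eq0 opprB.
  (* A relation between [f] and its shift by [a] is a three-point relation with [a] and [b]
     exchanged, in which the shift by [b] has coefficient 0. *)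
  case: (three_point_independent D0' F0).
  move: rel; rewrite addrC => /(span_solve c1n); apply.
  by apply: (LZ); apply: in_span_mem; rewrite !inE eqxx.
rewrite c1_0 scale0r addr0 in rel.
have c0_0 : c0 = 0.
  apply/eqP; move: rel; rewrite L2norm2_Z => /eqP.
  rewrite mulf_eq0 sqrf_eq0 (gt_eqF F0) orbF => /eqP/eq0_normc ->.
  by rewrite eqxx.
move=> i; case: (unliftP ord0 i) => [j|] -> //.
case: (unliftP ord0 j) => [k|] -> //.
case: (unliftP ord0 k) => [l|] -> //.
by rewrite (ord1 l).
Qed.
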